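(* Let $p$ be an odd prime, $n$ a positive integer, $\epsilon\in\{0,1\}$, and let $g(x)$ be a proper divisor of $\Delta_{n,\epsilon}(x)\in\mathbb{Z}_p[x]$. Let $G\le\mathrm{Aut}(\mathrm{C}_n^{(2)})$ be the group of all automorphisms of $\mathrm{C}_n^{(2)}$ that lift along the covering projection $\wp_{g(x)}\colon\Gamma_{g(x)}\to\mathrm{C}_n^{(2)}$, and let $d=\mathrm{Exp}(g(x))$. Then: (1) the kernel of the action of $G$ on the vertex set of $\mathrm{C}_n^{(2)}$ is isomorphic to $\mathbb{Z}_2^d$, and $G$ is vertex- and edge-transitive; (2) $G$ is arc-transitive if and only if $g(x)$ is weakly reflexible; in particular $G=\mathrm{Aut}(\mathrm{C}_n^{(2)})$ if and only if $g(x)=1$; (3) if $g(x)$ is not weakly reflexible, then $\wp_{g(x)}$ is a minimal $G$-admissible covering projection if and only if the associated polynomial $g_d(x)$ is a maximal divisor of $\Delta_{n/d,\epsilon}(x)$; (4) if $g(x)$ is weakly reflexible, then $\wp_{g(x)}$ is a minimal $G$-admissible covering projection if and only if $g_d(x)$ is a maximal weakly reflexible divisor of $\Delta_{n/d,\epsilon}(x)$; in particular, the covering projection arising from $g(x)=1$ is minimal $\mathrm{Aut}(\mathrm{C}_n^{(2)})$-admissible.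
   Context: Graphs. A graph is a quadruple $(D,V,\mathrm{beg},\mathrm{inv})$ of finite disjoint sets $D$ (darts) and $V\ne\emptyset$ (vertices), a map $\mathrm{beg}\colon D\to V$ and an involution $\mathrm{inv}\colon D\to D$, $x\mapsto x^{-1}$; edges are the orbits of $\mathrm{inv}$. Automorphisms are bijections of $V\cup D$ preserving $V$, $D$ and commuting with $\mathrm{beg}$ and $\mathrm{inv}$. Vertex-, edge-, arc-transitive means transitive on vertices, edges, darts. The doubled cycle $\mathrm{C}_n^{(2)}$ has vertex set $\mathbb{Z}_n$ and darts $a_i,b_i$ from $i$ to $i+1$ and their inverses $a_i^{-1},b_i^{-1}$, $i\in\mathbb{Z}_n$. Coverings. A covering projection $\wp\colon\tilde\Gamma\to\Gamma$ of connected graphs is a surjective morphism that is bijective from the darts at each vertex to the darts at its image. An automorphism $g$ of $\Gamma$ lifts if some automorphism $\tilde g$ of $\tilde\Gamma$ satisfies $\wp\circ\tilde g=g\circ\wp$; the set of automorphisms that lift is a group; $\wp$ is $G$-admissible if every element of $G$ lifts. A regular covering projection is one whose group of automorphisms fixing all fibres setwise is transitive on each fibre. A $G$-admissible regular covering projection is minimal if it is not a composite of a regular covering projection $\tilde\Gamma\to\Gamma'$ followed by a $G$-admissible regular covering projection $\Gamma'\to\Gamma$, neither being an isomorphism. Polynomials. $\Delta_{n,\epsilon}(x)=x^n-(-1)^\epsilon$. A proper divisor of $\Delta_{n,\epsilon}(x)$ is a monic divisor of degree $<n$ (constant $1$ allowed). $\mathrm{exp}(f)$ is the set of positive integers $k$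 with $f(x)=h(x^k)$ for some $h$; for nonconstant $f$, $\mathrm{Exp}(f)=\max\mathrm{exp}(f)$ and the associated polynomial $f_d$ satisfies $f(x)=f_d(x^d)$, $d=\mathrm{Exp}(f)$; for the constant $1$ regarded as divisor of $\Delta_{n,\epsilon}$, $\mathrm{Exp}(1)=n$ and its associated polynomial is $1$. A nonzero $f=\sum_{i=0}^m\alpha_ix^i$ of degree $m$ is reflexible if for some $\lambda\in\mathbb{Z}_p^*$ either $\lambda\alpha_{m-i}=\alpha_i$ for all $i$ (type 1) or $\lambda\alpha_{m-i}=(-1)^i\alpha_i$ for all $i$ (type 2). A nonconstant polynomial is weakly reflexible if its associated polynomial is reflexible; the constant $1$ (as a divisor) is weakly reflexible. A proper divisor $g$ of $\Delta_{n,\epsilon}$ is a maximal divisor if no proper divisor $h\ne g$ of $\Delta_{n,\epsilon}$ satisfies $g\mid h$; a weakly reflexible proper divisor $g$ is a maximal weakly reflexible divisor if no weakly reflexible proper divisor $h\ne g$ satisfies $g\mid h$. $\Gamma_{g(x)}$ and $\wp_{g(x)}$. For $g=\alpha_0+\dots+\alpha_mx^m$ a proper divisor, $r=n-m$, $M_{g(x)}\in\mathbb{Z}_p^{r\times n}$ has $k$-th row ($k=1,\dots,r$) with $\alpha_0,\dots,\alpha_m$ in columns $k,\dots,k+m$ and zeros elsewhere; $u_j$ is its $j$-th column. $\Gamma_{g(x)}$ has vertex set $\mathbb{Z}_p^r\times\mathbb{Z}_n$ with $(v,j)\sim(v\pm u_{j+1},j+1)$ (column index $j+1$ in $\{1,\dots,n\}$,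 second coordinate mod $n$). $\wp_{g(x)}$ maps $(v,j)\mapsto j$, the arc $(v,j)\to(v+u_{j+1},j+1)$ to $a_j$ and the arc $(v,j)\to(v-u_{j+1},j+1)$ to $b_j$.
   Formalization: The claims that the kernel is isomorphic to Z_2^d, that G = Aut(C_n^(2)) iff g(x) = 1, and that the covering for g(x) = 1 is minimal Aut-admissible are stated only for n ≥ 3, since they fail for n = 1 and 2 (e.g. n = 1, g = 1: kernel of order 4); all other claims are for every n ≥ 1. *)

(* Defs.v *)
From HB Require Import structures.
From mathcomp Require Import all_boot all_order all_fingroup all_algebra.

Set Implicit Arguments.
Unset Strict Implicit.
Unset Printing Implicit Defensive.

Import GRing.Theory GroupScope.

Local Open Scope ring_scope.

(* As usual for graphs with darts, [inv] may have fixed points. *)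
Record graph := Graph {
  vert : finType;
  dart : finType;
  beg : dart -> vert;
  inv : dart -> dart;
  inv_inv : involutive inv;
  vert_neq0 : (0 < #|vert|)%N
}.

Arguments beg {g} _.
Arguments inv {g} _.

Definition edges (A : graph) : {set {set dart A}} :=
  [set [set x; inv x] | x : dart A].

Definition adjacent (A : graph) : rel (vert A) :=
  fun u v => [exists x : dart A, (beg x == u) && (beg (inv x) == v)].

Definition connected (A : graph) : Prop :=
  forall u v : vert A, connect (@adjacent A) u v.

(* A bijection of the disjoint union of V and D preserving V and D is a pair  *)
(* of permutations; such pairs form a finGroupType (the external product).    *)
Definition vdperm (A : graph) : finGroupType :=
  ({perm vert A} * {perm dart A})%type.

Definition vperm A (f : vdperm A) : {perm vert A} := f.1.
Definition dperm A (f : vdperm A) : {perm dart A} := f.2.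

Lemma vpermM A (f g : vdperm A) v : vperm (f * g)%g v = vperm g (vperm f v).
Proof. exact: permM. Qed.

Lemma dpermM A (f g : vdperm A) x : dperm (f * g)%g x = dperm g (dperm f x).
Proof. exact: permM. Qed.

Lemma vperm1 A v : vperm (1%g : vdperm A) v = v.
Proof. exact: perm1. Qed.

Lemma dperm1 A x : dperm (1%g : vdperm A) x = x.
Proof. exact: perm1. Qed.

Definition vact A (v : vert A) (f : vdperm A) : vert A := vperm f v.
Definition dact A (x : dart A) (f : vdperm A) : dart A := dperm f x.

Canonical vact_action A : {action vdperm A &-> vert A} :=
  @TotalAction _ _ (@vact A) (@vperm1 A) (fun v f g => vpermM f g v).
Canonical dact_action A : {action vdperm A &-> dart A} :=
  @TotalAction _ _ (@dact A) (@dperm1 A) (fun x f g => dpermM f g x).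

Definition Aut_graph (A : graph) : {set vdperm A} :=
  [set f | [forall x : dart A, (beg (dperm f x) == vperm f (beg x)) &&
                               (inv (dperm f x) == dperm f (inv x))]].

Lemma Aut_graphP A (f : vdperm A) :
  reflect ((forall x, beg (dperm f x) = vperm f (beg x)) /\
           (forall x, inv (dperm f x) = dperm f (inv x)))
          (f \in Aut_graph A).
Proof.
rewrite inE; apply: (iffP forallP) => [H | [Hb Hi] x].
  by split=> x; case/andP: (H x) => /eqP ? /eqP ?.
by rewrite Hb Hi !eqxx.
Qed.

Lemma Aut_graph_group_set A : group_set (Aut_graph A).
Proof.
apply/group_setP; split.
  by apply/Aut_graphP; split=> x; rewrite !dperm1 ?vperm1.
move=> f g /Aut_graphP[fb fi] /Aut_graphP[gb gi].
by apply/Aut_graphP; split=> x; rewrite !dpermM ?vpermM ?gb ?fb ?gi ?fi.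
Qed.

Canonical Aut_graph_group A := group (Aut_graph_group_set A).

Record morph (A B : graph) := Morph {
  mvert : vert A -> vert B;
  mdart : dart A -> dart B;
  morph_beg : forall x, beg (mdart x) = mvert (beg x);
  morph_inv : forall x, inv (mdart x) = mdart (inv x)
}.

Definition isomorphism A B (f : morph A B) : Prop :=
  bijective (mvert f) /\ bijective (mdart f).

Definition is_composite A B C (f : morph A C) (f1 : morph A B) (f2 : morph B C)
    : Prop :=
  (forall v, mvert f v = mvert f2 (mvert f1 v)) /\
  (forall x, mdart f x = mdart f2 (mdart f1 x)).

Definition covering_projection A B (f : morph A B) : Prop :=
  [/\ connected A /\ connected B,
      forall w, exists v, mvert f v = w,
      forall y, exists x, mdart f x = y &
      forall v, {in [pred x | beg x == v] &, injective (mdart f)} /\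
                forall y, beg y = mvert f v ->
                  exists2 x, beg x = v & mdart f x = y].

Definition is_lift A B (f : morph A B) (h : vdperm A) (g : vdperm B) : bool :=
  [forall v, mvert f (vperm h v) == vperm g (mvert f v)] &&
  [forall x, mdart f (dperm h x) == dperm g (mdart f x)].

Lemma is_liftP A B (f : morph A B) h g :
  reflect ((forall v, mvert f (vperm h v) = vperm g (mvert f v)) /\
           (forall x, mdart f (dperm h x) = dperm g (mdart f x)))
          (is_lift f h g).
Proof.
apply: (iffP andP) => [[/forallP Hv /forallP Hd] | [Hv Hd]].
  by split=> x; apply/eqP.
by split; apply/forallP=> x; apply/eqP.
Qed.

Definition lifting_set A B (f : morph A B) : {set vdperm B} :=
  [set g in Aut_graph B | [exists h in Aut_graph A, is_lift f h g]].

Lemma lifting_group_set A B (f : morph A B) : group_set (lifting_set f).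
Proof.
apply/group_setP; split.
  apply/setIdP; split; first exact: group1.
  apply/exists_inP; exists 1%g; first exact: group1.
  by apply/is_liftP; split=> x; rewrite ?vperm1 ?dperm1.
move=> g1 g2 /setIdP[Ag1 /exists_inP[h1 Ah1 /is_liftP[v1 d1]]].
case/setIdP=> Ag2 /exists_inP[h2 Ah2 /is_liftP[v2 d2]].
apply/setIdP; split; first exact: groupM.
apply/exists_inP; exists (h1 * h2)%g; first exact: groupM.
by apply/is_liftP; split=> x; rewrite ?vpermM ?dpermM ?v2 ?d2 ?v1 ?d1.
Qed.

Canonical lifting_group A B (f : morph A B) := group (lifting_group_set f).

Definition admissible A B (f : morph A B) (G : {set vdperm B}) : Prop :=
  G \subset lifting_set f.

(* The automorphisms fixing all vertex- and dart-fibres setwise are the lifts *)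
(* of the identity.                                                           *)
Definition fibre_fixing A B (f : morph A B) : {set vdperm A} :=
  [set h in Aut_graph A | is_lift f h 1%g].

Definition regular_covering A B (f : morph A B) : Prop :=
  [/\ covering_projection f,
      forall u v, mvert f u = mvert f v ->
        exists2 h, h \in fibre_fixing f & vact u h = v &
      forall x y, mdart f x = mdart f y ->
        exists2 h, h \in fibre_fixing f & dact x h = y].

Definition minimal_admissible A B (f : morph A B) (G : {set vdperm B}) : Prop :=
  [/\ regular_covering f, admissible f G &
      ~ exists (C : graph) (f1 : morph A C) (f2 : morph C B),
          [/\ is_composite f f1 f2,
              regular_covering f1 /\ ~ isomorphism f1 &
              [/\ regular_covering f2, admissible f2 G & ~ isomorphism f2]]].

Section DoubledCycle.

Variables (n : nat) (n_gt0 : (0 < n)%N).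

(* The dart (i, b, s) is a_i if b = false and b_i if b = true, replaced by    *)
(* its inverse if s = true. The vertices 'I_n stand for Z_n, with             *)
(* ordS i = i + 1 mod n.                                                      *)
Definition dc_dart : finType := ('I_n * bool * bool)%type.

Definition dc_beg (x : dc_dart) : 'I_n :=
  let: (i, _, s) := x in if s then ordS i else i.

Definition dc_inv (x : dc_dart) : dc_dart :=
  let: (i, b, s) := x in (i, b, ~~ s).

Lemma dc_inv_inv : involutive dc_inv.
Proof. by case=> [[i b] s]; rewrite /= negbK. Qed.

Lemma dc_vert_neq0 : (0 < #|'I_n|)%N.
Proof. by rewrite card_ord. Qed.

Definition doubled_cycle : graph := Graph dc_beg dc_inv_inv dc_vert_neq0.

End DoubledCycle.

Section Polynomials.

Variable p : nat.

Definition Delta (n : nat) (eps : bool) : {poly 'F_p} :=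
  'X^n - ((-1) ^+ eps)%:P.

Definition proper_divisor n eps (g : {poly 'F_p}) : Prop :=
  [/\ g \is monic, g %| Delta n eps & ((size g).-1 < n)%N].

(* The only h that can satisfy f(x) = h(x^k) when k > 0, see in_expP.         *)
Definition contract (k : nat) (f : {poly 'F_p}) : {poly 'F_p} :=
  \poly_(i < size f) f`_(i * k).

Definition in_exp (f : {poly 'F_p}) : pred nat :=
  fun k => (0 < k)%N && (f == contract k f \Po 'X^k).

(* For constant f this is only meant for f = 1, regarded as a divisor of      *)
(* Delta n eps. For nonconstant f, all members of exp(f) are < size f, see    *)
(* Exp_max.                                                                   *)
Definition Exp (n : nat) (f : {poly 'F_p}) : nat :=
  if (size f <= 1)%N then n else \max_(k < size f | in_exp f k) k.

Definition associated n f : {poly 'F_p} := contract (Exp n f) f.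

Definition reflexible (f : {poly 'F_p}) : Prop :=
  let m := (size f).-1 in
  f != 0 /\ exists2 lambda : 'F_p, lambda != 0 &
    (forall i, (i <= m)%N -> lambda * f`_(m - i) = f`_i) \/
    (forall i, (i <= m)%N -> lambda * f`_(m - i) = (-1) ^+ i * f`_i).

Definition weakly_reflexible n (f : {poly 'F_p}) : Prop :=
  f = 1 \/ (1 < size f)%N /\ reflexible (associated n f).

Definition maximal_divisor n eps (g : {poly 'F_p}) : Prop :=
  proper_divisor n eps g /\
  forall h, proper_divisor n eps h -> g %| h -> h = g.

Definition maximal_weakly_reflexible_divisor n eps (g : {poly 'F_p}) : Prop :=
  [/\ proper_divisor n eps g, weakly_reflexible n g &
      forall h, proper_divisor n eps h -> weakly_reflexible n h -> g %| h ->
        h = g].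

Lemma contract_comp k (h : {poly 'F_p}) :
  (0 < k)%N -> contract k (h \Po 'X^k) = h.
Proof.
move=> k_gt0; apply/polyP=> i; rewrite coef_poly.
have coefE j : (h \Po 'X^k)`_(j * k) = h`_j.
  by rewrite coef_comp_poly_Xn // dvdn_mull // mulnK.
rewrite coefE; case: ltnP => // le_i.
rewrite -coefE nth_default //; apply: leq_trans le_i _.
by rewrite leq_pmulr.
Qed.

Lemma in_expP (f : {poly 'F_p}) k :
  reflect ((0 < k)%N /\ exists h : {poly 'F_p}, f = h \Po 'X^k) (in_exp f k).
Proof.
apply: (iffP andP) => [[k_gt0 /eqP fE]|[k_gt0 [h fE]]]; split=> //.
  by exists (contract k f).
by rewrite {2}fE contract_comp // fE.
Qed.

Lemma in_exp_lt (f : {poly 'F_p}) k :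
  (1 < size f)%N -> in_exp f k -> (k < size f)%N.
Proof.
move=> f_gt1 /in_expP[k_gt0 [h fE]].
have := size_comp_poly h 'X^k; rewrite -fE size_polyXn /= => sE.
rewrite -(ltn_predK f_gt1) ltnS sE.
case: (size h) sE => [|[|s]] /= sE; last by rewrite mulSn leq_addr.
  by rewrite mul0n in sE; case: (size f) f_gt1 sE => [|[]].
by rewrite mul0n in sE; case: (size f) f_gt1 sE => [|[]].
Qed.

Lemma Exp_const n (f : {poly 'F_p}) : (size f <= 1)%N -> Exp n f = n.
Proof. by rewrite /Exp => ->. Qed.

Lemma Exp_max n (f : {poly 'F_p}) : (1 < size f)%N ->
  in_exp f (Exp n f) /\ forall k, in_exp f k -> (k <= Exp n f)%N.
Proof.
move=> f_gt1; rewrite /Exp leqNgt f_gt1 /=; split=> [|k fk].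
  have f1 : in_exp f (Ordinal f_gt1).
    by apply/in_expP; split=> //; exists f; rewrite expr1 comp_polyXr.
  pose P (k : 'I_(size f)) := in_exp f k.
  rewrite (@bigop.bigmax_eq_arg _ (Ordinal f_gt1) P (@nat_of_ord _) f1).
  by case: arg_maxnP.
pose P (k : 'I_(size f)) := in_exp f k.
exact: (@bigop.leq_bigmax_cond _ P (@nat_of_ord _)
          (Ordinal (in_exp_lt f_gt1 fk)) fk).
Qed.

Lemma associatedE n (f : {poly 'F_p}) : (1 < size f)%N ->
  f = associated n f \Po 'X^(Exp n f).
Proof. by case/(Exp_max n)=> /andP[_ /eqP]. Qed.

Lemma associated1 n : associated n 1 = 1.
Proof.
rewrite /associated /contract size_poly1 poly_def big_ord1 mul0n.
by rewrite coef1 eqxx scale1r expr0.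
Qed.

End Polynomials.

Section GammaG.

Variables (p n : nat) (n_gt0 : (0 < n)%N) (g : {poly 'F_p}).

Definition gamma_dim : nat := n - (size g).-1.

(* Rows and columns are numbered from 0, so column j is the vector u_(j+1).   *)
Definition gamma_mx : 'M['F_p]_(gamma_dim, n) :=
  \matrix_(k, j) if (k <= j)%N then g`_(j - k) else 0.

Definition gamma_vert : finType := ('cV['F_p]_gamma_dim * 'I_n)%type.

(* The dart (v, j, b, s) is the arc (v, j) -> (v + u_(j+1), j + 1) if         *)
(* b = false and (v, j) -> (v - u_(j+1), j + 1) if b = true, replaced by its  *)
(* inverse if s = true. For n >= 3 the graph is simple; for n <= 2 there can  *)
(* be parallel edges, which are kept apart by their labels.                   *)
Definition gamma_dart : finType := (gamma_vert * bool * bool)%type.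

Definition gamma_beg (x : gamma_dart) : gamma_vert :=
  let: (v, j, b, s) := x in
  if s then (v + (-1) ^+ b *: col j gamma_mx, ordS j) else (v, j).

Definition gamma_inv (x : gamma_dart) : gamma_dart :=
  let: (v, j, b, s) := x in (v, j, b, ~~ s).

Lemma gamma_inv_inv : involutive gamma_inv.
Proof. by case=> [[[v j] b] s]; rewrite /= negbK. Qed.

Lemma gamma_vert_neq0 : (0 < #|gamma_vert|)%N.
Proof. by apply/card_gt0P; exists (0, Ordinal n_gt0). Qed.

Definition Gamma : graph := Graph gamma_beg gamma_inv_inv gamma_vert_neq0.

Definition wp_vert (w : vert Gamma) : vert (doubled_cycle n_gt0) := w.2.

Definition wp_dart (x : dart Gamma) : dart (doubled_cycle n_gt0) :=
  let: (_, j, b, s) := x in (j, b, s).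

Lemma wp_beg x : beg (wp_dart x) = wp_vert (beg x).
Proof. by case: x => [[[v j] b] []]. Qed.

Lemma wp_inv x : inv (wp_dart x) = wp_dart (inv x).
Proof. by case: x => [[[v j] b] s]. Qed.

Definition wp : morph Gamma (doubled_cycle n_gt0) := Morph wp_beg wp_inv.

End GammaG.

(* Main.v *)
(* The row space of M_g consists of the polynomials of degree < n divisible   *)
(* by g, and an automorphism of the doubled cycle lifts along wp_g iff the    *)
(* signed permutation of coordinates that it induces preserves this space.    *)
(* The rotation acts as multiplication by x modulo Delta, hence lifts. Sign   *)
(* changes lift iff the signs are d-periodic, as they must map each x^k g to  *)
(* a scalar multiple of itself. A reflection reverses coefficients, so up to  *)
(* signs it lifts iff g_d is reflexible. Intermediate coverings correspond to *)
(* subspaces of the row space; those stable under the rotation are again the  *)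
(* multiples of a divisor h of Delta with g | h, and stability under the sign *)
(* changes means h(x) = h'(x^d).                                              *)

Require Import Defs.
From HB Require Import structures.
From mathcomp Require Import all_boot all_order all_fingroup all_algebra zify.

Set Implicit Arguments.
Unset Strict Implicit.
Unset Printing Implicit Defensive.

Import GRing.Theory GroupScope.

Local Open Scope ring_scope.

(** * Reversal and sign twists of polynomials *)

(** Uniqueness of lifts turns the theorem into linear algebra over the prime field. Lifts of the
    identity act on vertices as translations ([tr_unique]), so a lift of an automorphism induces an
    additive, hence linear, map of the voltage space, which must send each u_j, up to sign, to the
    voltage of the image edge. Hence an automorphism in the normal form [std] lifts iff its signed
    permutation of columns preserves the row space of [gamma_mx], that is, the multiples of g of
    degree below n ([lifts_preserves], [sub_gamma]).

    For n > 2 every automorphism becomes, after a power of the rotation, a flip of labels or a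
    reflection ([aut_cases]). The rotation always lifts, flips lift iff they are d-periodic
    ([flips_lifts], [flips_periodic]), and some reflection lifts iff the associated polynomial is
    reflexible ([reflection_lifts], [reflection_refl]). This yields (1) and (2); for n <= 2 every
    proper divisor is weakly reflexible ([refl_small]).

    For (3) and (4), a proper divisor h of Delta that is a multiple of g gives a linear quotient
    [mxm] of the covering, which refutes minimality as soon as whatever lifts along g also lifts
    along h ([not_minimal]). Conversely, an intermediate covering collapses a space W of
    translations; the annihilator of W, multiplied by [gamma_mx], is stable under all lifted
    automorphisms, so it consists of the multiples of some h ([code_generator],
    [intermediate_divisor]). The delicate point of (4) is that a weakly reflexible multiple h of g_d
    may be reflexible with another type, or only through its own associated polynomial;
    [intermediate_refl] then finds a divisor of h, still a proper multiple of g_d, that is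
    reflexible with the type of g_d. *)

Section Reversal.

Variable F : fieldType.
Implicit Types (f q : {poly F}) (s u : nat -> F).

(** Reversal relative to a fixed length [N] instead of the degree: this makes it linear, and with
    [N] equal to n it is the reversal of coordinates of a vector. *)
Definition revp N f : {poly F} := \poly_(i < N) f`_(N.-1 - i).

Lemma coef_revp N f i : (revp N f)`_i = if (i < N)%N then f`_(N.-1 - i) else 0.
Proof. by rewrite coef_poly. Qed.

Lemma size_revp N f : (size (revp N f) <= N)%N.
Proof. exact: size_poly. Qed.

Lemma revpD N f q : revp N (f + q) = revp N f + revp N q.
Proof.
apply/polyP=> i; rewrite coefD !coef_revp.
by case: ifP => _; rewrite ?coefD ?addr0.
Qed.

Lemma revpZ N c f : revp N (c *: f) = c *: revp N f.
Proof.
apply/polyP=> i; rewrite coefZ !coef_revp.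
by case: ifP => _; rewrite ?coefZ ?mulr0.
Qed.

Lemma revpMX N f : (size f <= N)%N -> revp N.+1 (f * 'X) = revp N f.
Proof.
move=> sf; apply/polyP=> i; rewrite !coef_revp coefMX /= ltnS.
case: (ltngtP i N) => [iN|//|->]; last by rewrite subnn.
by rewrite subn_eq0 leqNgt iN /=; congr (f`_ _); lia.
Qed.

Lemma revp_widen N K f :
  (size f <= N)%N -> revp (N + K) f = 'X^K * revp N f.
Proof.
move=> sf; apply/polyP=> i; rewrite coefXnM !coef_revp.
case: (ltnP i K) => iK.
  rewrite ltn_addl // nth_default //. apply: leq_trans sf _; lia.
by rewrite ltn_subLR // addnC; case: ifP => // iKN; congr (f`_ _); lia.
Qed.

(** Induction on [k], peeling off the constant term: f = f' X + c. Multiplying by X is absorbed by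
    the longer length, and lengthening by K multiplies the reversal by X^K. *)
Lemma revpM k l f q : (size f <= k.+1)%N -> (size q <= l.+1)%N ->
  revp (k + l).+1 (f * q) = revp k.+1 f * revp l.+1 q.
Proof.
elim: k f => [|k IH] f sf sq.
  rewrite add0n (size1_polyC sf) mul_polyC revpZ.
  have -> : revp 1 (f`_0)%:P = (f`_0)%:P.
    by apply/polyP=> [[|i]]; rewrite coef_revp ?coefC.
  by rewrite mul_polyC.
have [f' c fE] : exists2 f' : {poly F}, exists c : F, f
  = f' * 'X + c%:P & (size f' <= k.+1)%N.
  exists (drop_poly 1 f); last by rewrite size_drop_poly; lia.
  exists f`_0; rewrite -[LHS](poly_take_drop 1) addrC expr1; congr (_ + _).
  by apply/polyP=> [[|i]]; rewrite coef_take_poly coefC.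
case: c fE => c -> sf'.
have sC : (size c%:P <= 1)%N by rewrite size_polyC; case: eqP.
rewrite mulrDl !revpD (mulrAC f') addSn (@revpMX (k + l).+1); last first.
  by apply: (leq_trans (size_mul_leq _ _)); lia.
rewrite IH // revpMX // mulrDl mul_polyC revpZ.
have -> : (k + l).+2 = (l.+1 + k.+1)%N by lia.
rewrite (revp_widen _ sq) -[k.+2]add1n (revp_widen _ sC).
have -> : revp 1 c%:P = c%:P.
  by apply/polyP=> [[|i]]; rewrite coef_revp ?coefC.
by rewrite -mulrA mul_polyC -scalerAr.
Qed.

Lemma revpK N f : (size f <= N)%N -> revp N (revp N f) = f.
Proof.
move=> sf; apply/polyP=> i; rewrite !coef_revp.
case: ifP => iN; last by rewrite nth_default //; apply: leq_trans sf _; lia.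
by rewrite ifT; [congr (f`_ _)|]; lia.
Qed.

Lemma size_revp_size f : f`_0 != 0 -> size (revp (size f) f) = size f.
Proof.
move=> f0; have f_gt0 : (0 < size f)%N.
  by rewrite lt0n size_poly_eq0; apply: contraNneq f0 => ->; rewrite coef0.
by rewrite size_poly_eq // subnn.
Qed.

Definition twist s f : {poly F} := \poly_(i < size f) (s i * f`_i).

Lemma coef_twist s f i : (twist s f)`_i = s i * f`_i.
Proof.
by rewrite coef_poly; case: ltnP => // sf; rewrite nth_default ?mulr0.
Qed.

Lemma twistZ s c f : twist s (c *: f) = c *: twist s f.
Proof. by apply/polyP=> i; rewrite coefZ !coef_twist coefZ mulrCA. Qed.

(** Compatibility of the signs is asked only on the support of [q], so that it covers periodic signs
    ([u] constant 1) and signs read at i / d, when [q] is a polynomial in x^d. *)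
Lemma twistM s u f q :
    (forall i j, q`_i != 0 -> s (j + i)%N = s j * u i) ->
  twist s (f * q) = twist s f * twist u q.
Proof.
move=> su; apply/polyP=> i; rewrite coef_twist !coefM big_distrr /=.
apply: eq_bigr => j _; rewrite !coef_twist.
have [->|nz] := eqVneq q`_(i - j) 0; first by rewrite !mulr0.
rewrite -{1}(@subnKC j i) ?su //; last by rewrite -ltnS ltn_ord.
by rewrite mulrACA.
Qed.

Lemma twistK s f : (forall i, s i * s i = 1) -> twist s (twist s f) = f.
Proof.
by move=> s1; apply/polyP=> i; rewrite !coef_twist mulrA s1 mul1r.
Qed.

Lemma twist_id s f : (forall i, f`_i != 0 -> s i = 1) -> twist s f = f.
Proof.
move=> s1; apply/polyP=> i; rewrite coef_twist.
by have [->|/s1->] := eqVneq f`_i 0; rewrite ?mulr0 ?mul1r.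
Qed.

Lemma size_twist s f : (forall i, s i != 0) -> size (twist s f) = size f.
Proof.
move=> s_nz; apply/eqP; rewrite eqn_leq size_poly /=.
apply/leq_sizeP=> j /leq_sizeP/(_ j (leqnn j))/eqP.
by rewrite coef_twist mulf_eq0 (negPf (s_nz j)) => /eqP.
Qed.

Lemma twist_dvd s u f q : (forall i j, s (j + i)%N = s j * u i) ->
  f %| q -> twist u f %| twist s q.
Proof. by move=> su /dvdpP[h ->]; rewrite (twistM _ (u := u)) ?dvdp_mulIr. Qed.

End Reversal.

(** * Exponents, associated polynomials and divisors of Delta *)

Section Exponents.

Variable p : nat.
Implicit Types (f g h q : {poly 'F_p}) (n d k : nat).

Lemma in_exp_suppP f k : (0 < k)%N ->
  in_exp f k <-> (forall i, f`_i != 0 -> (k %| i)%N).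
Proof.
move=> k_gt0; split=> [/in_expP[_ [h ->]] i|supp].
  by rewrite coef_comp_poly_Xn //; case: ifP; rewrite ?eqxx.
rewrite /in_exp k_gt0; apply/eqP/polyP=> i.
rewrite coef_comp_poly_Xn // coef_poly.
case: ifPn => [/dvdnP[j ->]|ki]; last by apply/eqP; apply: contraNT ki => /supp.
rewrite mulnK //; case: ltnP => // le_j.
by rewrite nth_default // (leq_trans le_j) // leq_pmulr.
Qed.

Lemma in_exp_lcm f k l : in_exp f k -> in_exp f l -> in_exp f (lcmn k l).
Proof.
move=> fk fl; have [k_gt0 l_gt0] : (0 < k)%N /\ (0 < l)%N.
  by case/andP: fk => -> _; case/andP: fl => ->.
apply/in_exp_suppP; first by rewrite lcmn_gt0 k_gt0.
move=> i fi; rewrite dvdn_lcm.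
by move/in_exp_suppP: fk => -> //; move/in_exp_suppP: fl => ->.
Qed.

Lemma Exp_gt0 n f : (0 < n)%N -> (0 < Exp n f)%N.
Proof.
move=> n_gt0; case: (leqP (size f) 1) => [/(Exp_const n)-> //|f_gt1].
by have [/andP[]] := Exp_max n f_gt1.
Qed.

(** exp(f) is closed under least common multiples, so its maximum is a multiple of each member. *)
Lemma in_exp_dvd_Exp n f k : (1 < size f)%N -> in_exp f k -> (k %| Exp n f)%N.
Proof.
move=> f_gt1 fk; have [fE maxE] := Exp_max n f_gt1.
have := maxE _ (in_exp_lcm fk fE).
have E_gt0 : (0 < Exp n f)%N by case/andP: fE.
have k_gt0 : (0 < k)%N by case/andP: fk.
have L_gt0 : (0 < lcmn k (Exp n f))%N by rewrite lcmn_gt0 k_gt0.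
move=> leE; suff -> : Exp n f = lcmn k (Exp n f) by rewrite dvdn_lcml.
by apply/eqP; rewrite eqn_leq leE dvdn_leq // dvdn_lcmr.
Qed.

Lemma size_comp_Xn h d :
  (0 < d)%N -> h != 0 -> size (h \Po 'X^d) = ((size h).-1 * d).+1.
Proof.
move=> d_gt0 h_nz; have := size_comp_poly h 'X^d.
rewrite size_polyXn /= => <-; rewrite prednK // lt0n size_poly_eq0.
by rewrite comp_poly_eq0 // size_polyXn ltnS.
Qed.

Lemma size_comp_Xn_gt1 h d :
  (0 < d)%N -> (1 < size (h \Po 'X^d))%N = (1 < size h)%N.
Proof.
move=> d_gt0; have [->|h_nz] := eqVneq h 0;
  first by rewrite comp_poly0 size_poly0.
rewrite size_comp_Xn // ltnS muln_gt0 d_gt0 andbT.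
by case: (size h) => [|[]].
Qed.

(** Since d is in exp(h(x^d)), it divides the maximum, and dividing supports by d leaves exp(h). The
    indices [n] and [n'] are unrelated because [Exp] reads them only at constants. *)
Lemma Exp_comp n n' h d : (0 < d)%N -> (1 < size h)%N ->
  Exp n (h \Po 'X^d) = (d * Exp n' h)%N.
Proof.
move=> d_gt0 h_gt1.
have f_gt1 : (1 < size (h \Po 'X^d))%N by rewrite size_comp_Xn_gt1.
have [fE maxE] := Exp_max n f_gt1; have [hE maxh] := Exp_max n' h_gt1.
have E_gt0 : (0 < Exp n (h \Po 'X^d))%N by case/andP: fE.
have Eh_gt0 : (0 < Exp n' h)%N by case/andP: hE.
have /dvdnP[e defE] : (d %| Exp n (h \Po 'X^d))%N.
  by apply: in_exp_dvd_Exp => //; apply/in_expP; split=> //; exists h.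
have e_gt0 : (0 < e)%N by move: E_gt0; rewrite defE muln_gt0 => /andP[].
apply/eqP; rewrite eqn_leq {1}defE mulnC leq_pmul2l //; apply/andP; split.
  apply/maxh/in_exp_suppP => // i hi.
  have := (in_exp_suppP _ E_gt0).1 fE (i * d)%N.
  rewrite coef_comp_poly_Xn // dvdn_mull // mulnK // defE dvdn_pmul2r //.
  exact.
apply/maxE/in_exp_suppP=> [|i]; first by rewrite muln_gt0 d_gt0.
rewrite coef_comp_poly_Xn //; case: ifP => [/dvdnP[j ->]|_];
  last by rewrite eqxx.
by rewrite mulnK // mulnC dvdn_pmul2r // => /((in_exp_suppP _ Eh_gt0).1 hE).
Qed.

Lemma associated_comp n n' h d : (0 < d)%N -> (1 < size h)%N ->
  associated n (h \Po 'X^d) = associated n' h.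
Proof.
move=> d_gt0 h_gt1; have Eh_gt0 : (0 < Exp n' h)%N.
  by have [/andP[]] := Exp_max n' h_gt1.
rewrite /associated (Exp_comp n n') //.
rewrite [in contract _ (h \Po _)](associatedE n' h_gt1) -comp_polyA
  comp_Xn_poly -exprM.
by rewrite -associatedE // contract_comp // muln_gt0 d_gt0.
Qed.

(** Substituting x^d in a Euclidean division gives a Euclidean division again: the remainder stays
    shorter than the divisor. *)
Lemma dvdp_comp_Xn h q d : (0 < d)%N -> (h \Po 'X^d %| q \Po 'X^d) = (h %| q).
Proof.
move=> d_gt0; apply/idP/idP; last first.
  by case/dvdpP=> a ->; rewrite comp_polyM dvdp_mulIr.
have X_gt1 : (1 < size ('X^d : {poly 'F_p}))%N by rewrite size_polyXn ltnS.
have [->|h_nz] := eqVneq h 0.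
  rewrite comp_poly0 dvd0p comp_poly_eq0 // => /eqP->.
  exact: dvdpp.
rewrite {1}(divp_eq q h) comp_polyD comp_polyM.
rewrite dvdp_addr ?dvdp_mulIr // => /dvdp_leq le_s.
rewrite /dvdp; apply: contraT => r_nz.
have := le_s; rewrite comp_poly_eq0 // => /(_ r_nz).
rewrite !size_comp_Xn // ltnS leq_pmul2r // => le_r.
have r_gt0 : (0 < size (q %% h)%R)%N by rewrite lt0n size_poly_eq0.
have lt_r : (size (q %% h)%R < size h)%N by rewrite ltn_modp.
by move: le_r; rewrite leqNgt (prednK r_gt0) -ltnS (ltn_predK lt_r) lt_r.
Qed.

Lemma size_Delta n eps : (0 < n)%N -> size (Delta p n eps) = n.+1.
Proof.
move=> n_gt0; rewrite /Delta size_polyDl size_polyXn // size_polyN.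
by rewrite size_polyC; case: eqP => //=; rewrite ltnS.
Qed.

Lemma Delta0 n eps : (0 < n)%N -> (Delta p n eps)`_0 = - (-1) ^+ eps.
Proof.
by move=> n_gt0; rewrite coefB coefXn coefC eqxx ltn_eqF // sub0r.
Qed.

Lemma Delta_comp n eps d : (d %| n)%N ->
  Delta p n eps = Delta p (n %/ d) eps \Po 'X^d.
Proof.
move=> dn; rewrite /Delta comp_polyB comp_polyC comp_Xn_poly -exprM.
by rewrite mulnC divnK.
Qed.

Lemma dvd_Delta_coef0 n eps g :
  (0 < n)%N -> g %| Delta p n eps -> g`_0 != 0.
Proof.
move=> n_gt0 /dvdpP[q defD]; have := Delta0 eps n_gt0.
rewrite defD coef0M; apply: contra_eqN => /eqP->.
by rewrite mulr0 eq_sym oppr_eq0 signr_eq0.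
Qed.

Lemma monic_size1 g : g \is monic -> (size g <= 1)%N -> g = 1.
Proof.
move=> /monicP lc /size1_polyC gE; move: lc; rewrite gE lead_coefC => ->.
by rewrite polyC1.
Qed.

Lemma associated_monicE n g : g \is monic ->
  g = associated n g \Po 'X^(Exp n g).
Proof.
move=> g_mon; case: (leqP (size g) 1) => [/(monic_size1 g_mon)->|].
  by rewrite associated1 -polyC1 comp_polyC.
exact: associatedE.
Qed.

(** Keeping only the coefficients at multiples of d maps multiples of g to multiples of g, as g is a
    polynomial in x^d. If d did not divide n, this would reduce Delta to its nonzero constant term,
    which a nonconstant g cannot divide. *)
Lemma Exp_dvdn n eps g : (0 < n)%N -> proper_divisor n eps g ->
  (Exp n g %| n)%N.
Proof.
move=> n_gt0 [g_mon g_dvd _].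
case: (leqP (size g) 1) => [/(Exp_const n)-> //|g_gt1].
have [gE _] := Exp_max n g_gt1; have E_gt0 := Exp_gt0 g n_gt0.
set d := Exp n g in gE E_gt0 *; apply: contraT => nd.
pose s i : 'F_p := (d %| i)%:R.
have supp := (in_exp_suppP _ E_gt0).1 gE.
have : g %| twist s (Delta p n eps).
  case/dvdpP: g_dvd => q ->.
  rewrite (twistM (u := fun _ => 1)) => [|i j /supp di]; last first.
    by rewrite /s mulr1 dvdn_addl.
  by rewrite (twist_id (s := fun _ => 1) (f := g)) // dvdp_mulIr.
have -> : twist s (Delta p n eps) = (- (-1) ^+ eps)%:P.
  apply/polyP=> i; rewrite coef_twist coefB coefXn !coefC /s.
  have [->|_] := eqVneq i n; first by rewrite (negPf nd) mul0r gtn_eqF.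
  by have [->|_] := eqVneq i 0%N; rewrite ?dvdn0 ?mul1r ?subr0 ?sub0r ?mulr0.
move/dvdp_leq; rewrite polyC_eq0 oppr_eq0 signr_eq0 => /(_ isT).
by rewrite size_polyC oppr_eq0 signr_eq0 leqNgt g_gt1.
Qed.

Lemma proper_divisor_comp n eps h d : (0 < n)%N -> (0 < d)%N -> (d %| n)%N ->
  proper_divisor n eps (h \Po 'X^d) <-> proper_divisor (n %/ d) eps h.
Proof.
move=> n_gt0 d_gt0 dn.
have X_gt1 : (1 < size ('X^d : {poly 'F_p}))%N by rewrite size_polyXn ltnS.
have mon : (h \Po 'X^d \is monic) = (h \is monic).
  by rewrite !monicE lead_coef_comp // lead_coefXn expr1n mulr1.
have sz : h \is monic ->
  ((size (h \Po 'X^d)).-1 < n)%N = ((size h).-1 < n %/ d)%N.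
  move=> /monic_neq0 h_nz.
  by rewrite size_comp_Xn //= -{1}(divnK dn) ltn_pmul2r.
split=> -[h_mon h_dvd h_sz].
  move: h_mon; rewrite mon => h_mon; split=> //; last by rewrite -sz.
  by rewrite -(dvdp_comp_Xn _ _ d_gt0) -Delta_comp.
split; rewrite ?mon ?sz //.
by rewrite (Delta_comp eps dn) dvdp_comp_Xn.
Qed.

Lemma proper_divisor_associated n eps g : (0 < n)%N -> proper_divisor n eps g ->
  proper_divisor (n %/ Exp n g) eps (associated n g).
Proof.
move=> n_gt0 g_div; apply/(proper_divisor_comp eps _ n_gt0).
- exact: Exp_gt0.
- exact: (Exp_dvdn n_gt0 g_div).
by rewrite -associated_monicE //; case: g_div.
Qed.

Lemma associated_size_gt1 n g : (1 < size g)%N -> (1 < size (associated n g))%N.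
Proof.
move=> g_gt1; rewrite -(@size_comp_Xn_gt1 _ (Exp n g)) -?associatedE //.
by have [/andP[]] := Exp_max n g_gt1.
Qed.

Lemma Exp_associated n n' g : (1 < size g)%N -> Exp n' (associated n g) = 1%N.
Proof.
move=> g_gt1; have E_gt0 : (0 < Exp n g)%N by have [/andP[]] := Exp_max n g_gt1.
apply/eqP; rewrite -(eqn_pmul2l E_gt0) muln1 -(Exp_comp n) -?associatedE //.
exact: associated_size_gt1.
Qed.

Lemma associated_idem n n' g : (1 < size g)%N ->
  associated n' (associated n g) = associated n g.
Proof.
move=> g_gt1; rewrite {1}/associated Exp_associated //.
by rewrite -[X in contract 1 X](comp_polyXr) -['X]expr1 contract_comp.
Qed.

End Exponents.

(** * Reflexible polynomials and reciprocals *)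

Section Reflexibility.

Variable p : nat.
Implicit Types (f g h q : {poly 'F_p}) (b : bool).

Definition alt b (i : nat) : 'F_p := (-1) ^+ (b * i)%N.

Lemma altD b i j : alt b (j + i)%N = alt b j * alt b i.
Proof. by rewrite /alt mulnDr exprD. Qed.

Lemma alt_sqr b i : alt b i * alt b i = 1.
Proof. by rewrite /alt -expr2 sqrr_sign. Qed.

Lemma alt_neq0 b i : alt b i != 0.
Proof. by rewrite /alt signr_eq0. Qed.

(* [refl false] is reflexibility of type 1 and [refl true] of type 2. *)
Definition refl b f : Prop :=
  exists2 lambda : 'F_p, lambda != 0 &
    lambda *: revp (size f) f = twist (alt b) f.

Lemma reflexibleP f : reflexible f <-> f != 0 /\ exists b, refl b f.
Proof.
have key b (l : 'F_p) : f != 0 ->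
    (forall i, (i <= (size f).-1)%N ->
      l * f`_((size f).-1 - i) = alt b i * f`_i)
    <-> l *: revp (size f) f = twist (alt b) f.
  rewrite -size_poly_eq0 => f_gt0; split=> [H|/polyP H i le_i].
    apply/polyP=> i; rewrite coefZ coef_twist coef_revp.
    case: ltnP => [lt_i|ge_i]; last by rewrite nth_default ?mulr0.
    by rewrite H // -ltnS prednK // lt0n.
  have := H i; rewrite coefZ coef_twist coef_revp ifT //.
  by rewrite -(ltnS i) prednK ?lt0n in le_i.
split=> [[f_nz [l l_nz [H|H]]]|[f_nz [[] [l l_nz /(key _ _ f_nz) H]]]].
- split=> //; exists false, l => //; apply/key => // i le_i.
  by rewrite H // /alt mul0n mul1r.
- split=> //; exists true, l => //; apply/key => // i le_i.
  by rewrite H // /alt mul1n.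
- by split=> //; exists l => //; right=> i /H->; rewrite /alt mul1n.
by split=> //; exists l => //; left=> i /H->; rewrite /alt mul0n mul1r.
Qed.

Lemma weakly_reflexibleP n g : g \is monic ->
  weakly_reflexible n g <-> exists b, refl b (associated n g).
Proof.
move=> g_mon; split=> [[->|[_ /reflexibleP[] //]]|[b rg]].
  exists false; rewrite associated1; exists 1; rewrite ?oner_eq0 // scale1r.
  rewrite size_poly1; apply/polyP=> i; rewrite coef_revp coef_twist.
  by rewrite /alt mul0n mul1r !coef1; case: i.
case: (leqP (size g) 1) => [/(monic_size1 g_mon)->|g_gt1]; [by left|right].
split=> //; apply/reflexibleP; split; last by exists b.
rewrite -size_poly_eq0 -lt0n.
exact: ltn_trans (associated_size_gt1 n g_gt1).
Qed.

(** The degree of f(x^d) is a multiple of d, so reversal preserves the multiples of d; off them both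
    sides vanish, and on them the sign is read at i / d. *)
Lemma refl_comp b f d : (0 < d)%N -> f != 0 -> refl b f ->
  exists2 lambda : 'F_p, lambda != 0 &
    lambda *: revp (size (f \Po 'X^d)) (f \Po 'X^d)
      = twist (fun i => alt b (i %/ d)) (f \Po 'X^d).
Proof.
move=> d_gt0 f_nz [l l_nz /polyP H]; exists l => //; apply/polyP=> i.
rewrite coefZ coef_twist coef_revp size_comp_Xn // ltnS /=.
case: leqP => [le_i|lt_i]; last first.
  by rewrite nth_default ?mulr0 // size_comp_Xn.
rewrite !coef_comp_poly_Xn // dvdn_subr //; last by rewrite dvdn_mull.
case: ifP => [/dvdnP[j defi]|_]; last by rewrite !mulr0.
move: le_i; rewrite defi leq_pmul2r // -mulnBl !mulnK // => le_j.
have := H j; rewrite coefZ coef_twist coef_revp ifT //.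
by rewrite -(prednK (n := size f)) ?ltnS // lt0n size_poly_eq0.
Qed.

(** The reciprocal polynomial x^m f(1/x), m = deg f, taken at -x when [b] holds. It is
    multiplicative on nonzero polynomials, and an involution up to scalars when f(0) is nonzero. *)
Definition recip b f := twist (alt b) (revp (size f) f).

Lemma size_recip b f : f`_0 != 0 -> size (recip b f) = size f.
Proof.
by move=> f0; rewrite size_twist ?size_revp_size // => i; apply: alt_neq0.
Qed.

Lemma coef0_neq0 f : f`_0 != 0 -> f != 0.
Proof. by apply: contraNneq => ->; rewrite coef0. Qed.

Lemma recipM b f q : f != 0 -> q != 0 ->
  recip b (f * q) = recip b f * recip b q.
Proof.
move=> f_nz q_nz; have := size_mul f_nz q_nz.
have: (0 < size f)%N by rewrite lt0n size_poly_eq0.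
have: (0 < size q)%N by rewrite lt0n size_poly_eq0.
rewrite /recip; case defl : (size q) => [//|l] _;
  case defk : (size f) => [//|k] _.
rewrite addSn /= addnS => ->;
  rewrite revpM ?defk ?defl // (twistM _ (u := alt b)) //.
by move=> i j _; rewrite altD.
Qed.

Lemma recip_dvd b f q : q != 0 -> f %| q -> recip b f %| recip b q.
Proof.
move=> q_nz /dvdpP[h defq]; move: q_nz;
  rewrite defq mulf_eq0 => /norP[h_nz f_nz].
by rewrite recipM // dvdp_mulIr.
Qed.

Lemma twist_alt_revp b N f : (size f <= N)%N ->
  twist (alt b) (revp N f) = alt b N.-1 *: revp N (twist (alt b) f).
Proof.
move=> sf; apply/polyP=> i; rewrite coefZ coef_twist !coef_revp coef_twist.
case: ltnP => lt_i; last by rewrite !mulr0.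
have le_i : (i <= N.-1)%N by case: N lt_i {sf}.
rewrite mulrA; congr (_ * _); rewrite -{1}(subnKC le_i) altD.
by rewrite -mulrA alt_sqr mulr1.
Qed.

Lemma recipK b f : f`_0 != 0 -> recip b (recip b f) %= f.
Proof.
move=> f0; rewrite {1}/recip size_recip // /recip.
rewrite twist_alt_revp; last by rewrite size_twist ?size_revp //;
  apply: alt_neq0.
rewrite twistK; last by move=> i; apply: alt_sqr.
by rewrite revpK // eqp_scale // alt_neq0.
Qed.

Lemma refl_recip b f : refl b f <-> recip b f %= f.
Proof.
split=> [[l l_nz defl]|].
  rewrite -(eqp_ltrans (eqp_scale _ l_nz)) -twistZ defl twistK ?eqpxx //.
  by move=> i; apply: alt_sqr.
case/eqpf_eq=> c c_nz defc; exists c^-1; rewrite ?invr_eq0 //.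
have := congr1 (twist (alt b)) defc; rewrite twistK; last first.
  by move=> i; apply: alt_sqr.
by rewrite twistZ => ->; rewrite scalerA mulVf // scale1r.
Qed.

Hypotheses (p_prime : prime p) (p_odd : odd p).

Lemma Fp2_neq0 : 2%:R != 0 :> 'F_p.
Proof.
rewrite -(dvdn_pcharf (pchar_Fp p_prime)).
by apply: contraL p_odd => /(dvdn_leq (isT : 0 < 2)%N);
  case: (p) p_prime => [|[|[|]]].
Qed.

Lemma Fp_double_eq0 (x : 'F_p) : x + x = 0 -> x = 0.
Proof.
by move/eqP; rewrite -mulr2n -mulr_natl mulf_eq0 (negPf Fp2_neq0) => /eqP.
Qed.

(** The constant coefficient forces the scalar to be 1, so the odd coefficients equal their
    negatives and vanish, p being odd. *)
Lemma twist_alt_eqp f : f`_0 != 0 -> twist (alt true) f %= f ->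
  forall i, f`_i != 0 -> (2 %| i)%N.
Proof.
move=> f0 /eqpf_eq[c c_nz /polyP H].
have c1 : c = 1.
  have := H 0%N; rewrite coef_twist coefZ /alt muln0 => /(mulIf f0) <-.
  by rewrite expr0.
move=> i; have := H i; rewrite coef_twist coefZ c1 mul1r /alt mul1n.
rewrite dvdn2 -signr_odd; case: odd => //; rewrite mulN1r => /eqP.
by rewrite eq_sym -addr_eq0 => /eqP/Fp_double_eq0->; rewrite eqxx.
Qed.

(* The polynomial found is gcd(h, h'), where h' is the type [b] reciprocal of *)
(* h. If it were f, then h' would not be associated to h, so that {h, h'} is  *)
(* stable under x |-> -x up to scalars; then f(-x) ~ f(x) and 2 is in exp(f). *)
Lemma intermediate_refl n n' b f h :
    f \is monic -> h \is monic -> h`_0 != 0 -> (1 < size f)%N ->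
    Exp n f = 1%N -> f %| h -> h != f -> refl b f -> weakly_reflexible n' h ->
  exists k, [/\ k \is monic, f %| k, k %| h, k != f & refl b k].
Proof.
move=> f_mon h_mon h0 f_gt1 Ef fh h_neq_f rf wh.
have h_nz := coef0_neq0 h0; have f_nz := monic_neq0 f_mon.
have alt_s i : alt true i * alt true i = 1 by apply: alt_sqr.
pose k0 := gcdp h (recip b h).
have k0_nz : k0 != 0 by rewrite gcdp_eq0 negb_and h_nz.
pose k := (lead_coef k0)^-1 *: k0.
have k_eqp : k %= k0 by rewrite eqp_scale // invr_eq0 lead_coef_eq0.
have k_mon : k \is monic.
  by rewrite monicE lead_coefZ mulVf // lead_coef_eq0.
have kh : k %| h by rewrite (eqp_dvdl _ k_eqp) dvdp_gcdl.
have kr : k %| recip b h by rewrite (eqp_dvdl _ k_eqp) dvdp_gcdr.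
have in_k q : q %| h -> q %| recip b h -> q %| k.
  by rewrite (eqp_dvdr _ k_eqp) dvdp_gcd => -> ->.
have coef0_dvd q : q %| h -> q`_0 != 0.
  by case/dvdpP=> a defh; move: h0; rewrite defh coef0M mulf_eq0 => /norP[].
have fk : f %| k.
  apply: in_k => //; move/refl_recip: rf => /eqp_dvdl <-.
  exact: recip_dvd.
have r_nz : recip b h != 0
  by rewrite -size_poly_eq0 size_recip // size_poly_eq0.
have k0' := coef0_dvd _ kh.
(* The reciprocal of k divides the reciprocal of h and, by involutivity, h itself; so it divides k,
   and it has the same size. *)
have rk : refl b k.
  apply/refl_recip; rewrite -dvdp_size_eqp ?size_recip //.
  apply: in_k; last exact: recip_dvd.
  by rewrite -(eqp_dvdr _ (recipK b h0)) recip_dvd.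
exists k; split=> //; apply/eqP=> kf.
have neg_f : ~ twist (alt true) f %= f.
  move/twist_alt_eqp => even_f.
  have /(in_exp_dvd_Exp n f_gt1) : in_exp f 2.
    by apply/in_exp_suppP => //; apply: even_f; rewrite -kf.
  by rewrite Ef.
(* If k(-x) divided both h and its reciprocal, it would divide k and be associate to it, against
   [neg_f] as k = f here. *)
have neg_dvd : twist (alt true) k %| h -> twist (alt true) k %| recip b h ->
  False.
  move=> d1 d2; apply: neg_f; rewrite -kf -dvdp_size_eqp; last exact: in_k.
  by rewrite size_twist // => i; apply: alt_neq0.
have neg_twist q : k %| q -> twist (alt true) k %| twist (alt true) q.
  by apply: twist_dvd => i j; apply: altD.
case: wh => [h1|[h_gt1 /reflexibleP[a_nz [b' ra]]]].
  by have := dvdp_leq h_nz fh; rewrite h1 size_poly1 leqNgt f_gt1.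
set e := Exp n' h; have e_gt0 : (0 < e)%N.
  by have [/andP[]] := Exp_max n' h_gt1.
have supp : forall i, h`_i != 0 -> (e %| i)%N.
  by apply/in_exp_suppP => //; have [] := Exp_max n' h_gt1.
(* The support of h lies in the multiples of e. For odd e, i and i / e have the same parity there,
   so h itself is reflexible with the type of its associated polynomial. *)
have [odd_e|even_e] := boolP (odd e).
  have rh : refl b' h.
    have [l l_nz] := refl_comp e_gt0 a_nz ra.
    rewrite /e -associatedE // => defl; exists l; rewrite // defl.
    apply/polyP=> i; rewrite !coef_twist.
    have [->|/supp/dvdnP[j ->]] := eqVneq h`_i 0; first by rewrite !mulr0.
    rewrite mulnK // /alt mulnA -[in RHS]signr_odd !oddM odd_e andbT.
    by rewrite -oddM signr_odd.
  case: rh => l l_nz defl.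
  have rE : recip b h %= twist (alt (b (+) b')) h.
    have -> : twist (alt (b (+) b')) h = l *: recip b h.
      rewrite /recip -twistZ defl; apply/polyP=> i; rewrite !coef_twist mulrA.
      congr (_ * _); rewrite /alt -exprD -mulnDl; clear.
      case: b b' => [] [] //=.
      by rewrite addn1 mul0n exprM sqrrN !expr1n.
    by rewrite eqp_sym eqp_scale.
  (* Equal types make h associate to its reciprocal, so h would divide k = f. Different types make
     the reciprocal associate to h(-x), so x -> -x exchanges the two. *)
  case: (altP (b =P b')) rE => [<-|bb']; rewrite ?addbb => rE.
    case/negP: h_neq_f; rewrite -kf -eqp_monic // /eqp kh andbT.
    apply: in_k => //; rewrite (eqp_dvdr _ rE) twist_id ?dvdpp //.
  have bb : b (+) b' = true by move: bb'; clear; case: b b' => [] [].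
  rewrite bb in rE; apply: neg_dvd; last by rewrite (eqp_dvdr _ rE) neg_twist.
  by rewrite -[h](twistK (s := alt true)) // neg_twist // -(eqp_dvdr _ rE).
(* For even e, both h and its reciprocal are fixed by x -> -x up to scalars. *)
have hN : twist (alt true) h = h.
  apply: twist_id => i /supp ei; rewrite /alt mul1n -signr_odd.
  by rewrite (negPf (contra (dvdn_odd ei) even_e)).
apply: neg_dvd; first by rewrite -hN neg_twist.
suff <- : alt true (size h).-1 *: twist (alt true) (recip b h) = recip b h.
  by rewrite dvdpZr ?alt_neq0 // neg_twist.
have -> : twist (alt true) (recip b h)
        = twist (alt b) (twist (alt true) (revp (size h) h)).
  by apply/polyP=> i; rewrite !coef_twist mulrCA.
by rewrite twist_alt_revp // hN twistZ scalerA alt_sqr scale1r.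
Qed.

End Reflexibility.

(** * Row spaces, unique lifting and the lifting criterion *)

Section Rows.

Variables (p n : nat) (g : {poly 'F_p}).
Hypotheses (g_nz : g != 0) (g_lt : ((size g).-1 < n)%N).

Lemma rVpolyE (F : fieldType) r (y : 'rV[F]_r) :
  rVpoly y = \sum_(k < r) y 0 k *: 'X^k.
Proof.
rewrite {1}[y]row_sum_delta linear_sum; apply: eq_bigr => k _.
by rewrite linearZ /= rVpoly_delta.
Qed.

Lemma size_g_dim : (gamma_dim n g + size g = n.+1)%N.
Proof.
have g_gt0 : (0 < size g)%N by rewrite lt0n size_poly_eq0.
by rewrite -(prednK g_gt0) addnS /gamma_dim subnK // ltnW.
Qed.

Lemma rVpoly_mul_gamma (y : 'rV_(gamma_dim n g)) :
  rVpoly (y *m gamma_mx n g) = rVpoly y * g.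
Proof.
apply/polyP=> j; case: (ltnP j n) => [lt_j|ge_j]; last first.
  rewrite !nth_default ?(leq_trans _ ge_j) // ?size_poly //.
  apply: leq_trans (size_polyMleq _ _) _; rewrite -ltnS -size_g_dim.
  have g_gt0 : (0 < size g)%N by rewrite lt0n size_poly_eq0.
  apply: (@leq_trans (size (rVpoly y) + size g));
    last by rewrite leq_add2r size_poly.
  by rewrite prednK // addn_gt0 g_gt0 orbT.
rewrite -[j]/(nat_of_ord (Ordinal lt_j)) coef_rVpoly_ord mxE rVpolyE.
rewrite mulr_suml coef_sum; apply: eq_bigr => k _.
rewrite mxE /= -scalerAl coefZ coefXnM leqNgt.
by case: (j < k)%N.
Qed.

Lemma size_quotient q : (size (q * g)%R <= n)%N -> (size q <= gamma_dim n g)%N.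
Proof.
have [->|q_nz] := eqVneq q 0; first by rewrite size_poly0.
rewrite size_mul // => le_s.
have q_gt0 : (0 < size q)%N by rewrite lt0n size_poly_eq0.
rewrite -(leq_add2r (size g)) size_g_dim.
by rewrite -(prednK (n := size q + size g)) ?ltnS // addn_gt0 q_gt0.
Qed.

(** Row k of the matrix is x^k g, so a combination of rows with coefficients y is the product of the
    polynomial y with g; the number of rows is exactly what degree below n permits. *)
Lemma sub_gamma (v : 'rV_n) : (v <= gamma_mx n g)%MS = (g %| rVpoly v).
Proof.
apply/idP/idP => [/submxP[y ->]|/dvdpP[q defv]].
  by rewrite rVpoly_mul_gamma dvdp_mulIr.
have sq : (size q <= gamma_dim n g)%N.
  by apply: size_quotient; rewrite -defv; apply: size_poly.
apply/submxP; exists (poly_rV q); apply: (can_inj rVpolyK).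
by rewrite rVpoly_mul_gamma poly_rV_K.
Qed.

Lemma row_free_gamma : row_free (gamma_mx n g).
Proof.
rewrite -kermx_eq0 -submx0; apply/rV_subP=> y /sub_kermxP yM0; rewrite submx0.
have /eqP := rVpoly_mul_gamma y;
  rewrite yM0 linear0 eq_sym mulf_eq0 (negPf g_nz).
by rewrite orbF => /eqP y0; apply/eqP/(can_inj rVpolyK); rewrite y0 linear0.
Qed.

End Rows.

Section SignedPerm.

Variables (p n : nat).
Implicit Types (sg : 'I_n -> 'I_n) (e : 'I_n -> bool) (g : {poly 'F_p}).

(* The action on row spaces of an automorphism that maps the edges of index   *)
(* j to those of index [sg j] and exchanges the labels a, b where [e j].      *)
Definition sperm sg e m (B : 'M['F_p]_(m, n)) : 'M['F_p]_(m, n) :=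
  \matrix_(i, j) ((-1) ^+ e j * B i (sg j)).

Lemma sperm_mul sg e m k (y : 'M_(k, m)) B :
  sperm sg e (y *m B) = y *m sperm sg e B.
Proof.
apply/matrixP=> i j; rewrite !mxE big_distrr; apply: eq_bigr => l _.
by rewrite mxE mulrCA.
Qed.

Lemma col_sperm sg e m (B : 'M_(m, n)) j :
  col j (sperm sg e B) = (-1) ^+ e j *: col (sg j) B.
Proof. by apply/colP=> i; rewrite !mxE. Qed.

Definition preserves sg e g : Prop :=
  forall v : 'rV['F_p]_n, g %| rVpoly v -> g %| rVpoly (sperm sg e v).

Lemma sperm_sub sg e m (B : 'M_(m, n)) :
  (forall v : 'rV_n, (v <= B)%MS -> (sperm sg e v <= B)%MS) ->
  (sperm sg e B <= B)%MS.
Proof.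
move=> H; apply/row_subP=> i; have := H _ (row_sub i B).
by rewrite rowE sperm_mul -rowE.
Qed.

Lemma row_free_sperm sg e m (B : 'M_(m, n)) :
  injective sg -> row_free B -> row_free (sperm sg e B).
Proof.
move=> sg_inj /row_freeP[D BD]; apply/row_freeP.
exists (\matrix_(j, i) ((-1) ^+ e j * D (sg j) i)).
rewrite -BD; apply/matrixP=> i k; rewrite !mxE.
rewrite [RHS](reindex_inj sg_inj); apply: eq_bigr => j _; rewrite !mxE.
by rewrite mulrACA -expr2 sqrr_sign mul1r.
Qed.

End SignedPerm.

Section UniqueLift.

Lemma covering_inj A B (f : morph A B) x y : covering_projection f ->
  beg x = beg y -> mdart f x = mdart f y -> x = y.
Proof.
by case=> _ _ _ /(_ (beg x))[inj_f _] bxy; apply: inj_f; rewrite inE ?bxy.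
Qed.

(** Agreement at one vertex spreads along every dart: the two images of the dart start at the same
    vertex and have the same projection, hence coincide. *)
Lemma unique_lift A B C (f : morph B C) (a b : morph A B) u0 :
    (forall x y, beg x = beg y -> mdart f x = mdart f y -> x = y) ->
    connected A -> (forall x, mdart f (mdart a x) = mdart f (mdart b x)) ->
    mvert a u0 = mvert b u0 ->
  forall u, mvert a u = mvert b u.
Proof.
move=> inj_f conA fab ab0 u.
have step pth : forall v, mvert a v = mvert b v -> path (@adjacent A) v pth ->
    mvert a (last v pth) = mvert b (last v pth).
  elim: pth => //= w pth IH v abv /andP[/existsP[x /andP[/eqP bx /eqP ix]]].
  apply: IH; have abx : mdart a x = mdart b x.
    by apply: inj_f => //; rewrite !morph_beg bx.
  by rewrite -ix -!morph_beg -!morph_inv abx.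
by case/connectP: (conA u0 u) => pth pathp ->; apply: step.
Qed.

Definition aut_morph A (h : vdperm A) (Ah : h \in Aut_graph A) : morph A A :=
  Morph ((Aut_graphP h Ah).1) ((Aut_graphP h Ah).2).

Definition comp_morph A B C (f : morph A B) (k : morph B C) : morph A C.
Proof.
exists (mvert k \o mvert f) (mdart k \o mdart f) => x /=.
  by rewrite !morph_beg.
by rewrite !morph_inv.
Defined.

End UniqueLift.

Section Translations.

Variables (p n : nat) (n_gt0 : (0 < n)%N) (g : {poly 'F_p}).
Notation r := (gamma_dim n g).
Notation M := (gamma_mx n g).
Notation Gm := (Gamma n_gt0 g).
Notation C := (doubled_cycle n_gt0).
Implicit Types (w : 'cV['F_p]_r) (phi : vdperm C).

Definition trv w (x : vert Gm) : vert Gm := (x.1 + w, x.2).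
Definition trd w (x : dart Gm) : dart Gm :=
  let: (v, j, b, s) := x in (v + w, j, b, s).

Lemma trv_inj w : injective (trv w).
Proof. by move=> [v j] [v' j'] [/addIr -> ->]. Qed.

Lemma trd_inj w : injective (trd w).
Proof. by move=> [[[v j] b] s] [[[v' j'] b'] s'] [/addIr -> -> -> ->]. Qed.

(** The deck transformations of [wp]; by [tr_unique] there are no others on vertices. *)
Definition tr w : vdperm Gm := (perm (@trv_inj w), perm (@trd_inj w)).

Lemma vperm_tr w x : vperm (tr w) x = trv w x.
Proof. exact: permE. Qed.

Lemma dperm_tr w x : dperm (tr w) x = trd w x.
Proof. exact: permE. Qed.

Lemma tr_Aut w : tr w \in Aut_graph Gm.
Proof.
apply/Aut_graphP; split=> -[[[v j] b] s]; rewrite !dperm_tr ?vperm_tr //=.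
by case: s; rewrite /trv //= addrAC.
Qed.

Lemma tr_lift w : is_lift (wp n_gt0 g) (tr w) 1%g.
Proof.
apply/is_liftP; split=> [[v j]|[[[v j] b] s]].
  by rewrite vperm_tr vperm1.
by rewrite dperm_tr dperm1.
Qed.

Lemma wp_inj (x y : dart Gm) :
  beg x = beg y -> mdart (wp n_gt0 g) x = mdart (wp n_gt0 g) y -> x = y.
Proof.
case: x y => [[[v j] b] s] [[[v' j'] b'] s'] /= ebeg [ej eb es].
by move: ebeg; rewrite ej eb es; case: s' {es} => -[] => [/addIr|] ->.
Qed.

Hypotheses (p_prime : prime p) (p_odd : odd p).
Hypotheses (g_nz : g != 0) (g_lt : ((size g).-1 < n)%N).

Lemma Fp_natE (c : 'F_p) : c = (nat_of_ord c)%:R.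
Proof. by rewrite natr_Zp. Qed.

Lemma iter_ordS k (i : 'I_n) : iter k (@ordS n) i = ((i + k) %% n)%N :> nat.
Proof.
elim: k => [|k IH]; first by rewrite addn0 modn_small.
by rewrite iterS /= IH -addn1 modnDml addn1 addnS.
Qed.

Lemma iter_ordS_trans (i j : 'I_n) : exists k, j = iter k (@ordS n) i.
Proof.
exists (n - i + j)%N; apply: val_inj; rewrite /= iter_ordS addnA subnKC;
  last first.
  exact: ltnW.
by rewrite modnDl modn_small.
Qed.

(** Going forward along a_j and back along b_j adds 2 u_j. As p is odd this reaches all multiples of
    u_j, and the columns u_j span because the matrix has full row rank. *)
Lemma Gamma_connected : connected Gm.
Proof.
have adj_sym : connect_sym (@adjacent Gm).
  apply: sym_connect_sym => u v; apply/existsP/existsP => -[x /andP[bx ix]];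
  by exists (Defs.inv x); rewrite ix inv_inv.
have stepu (b : bool) (v : 'cV['F_p]_r) (j : 'I_n) : connect (@adjacent Gm)
  (v, j) (v + (-1) ^+ b *: col j M, ordS j).
  apply/connect1/existsP; exists ((v, j, b, false) : dart Gm).
  by rewrite /= !eqxx.
have step2 (v : 'cV['F_p]_r) (j : 'I_n) : connect (@adjacent Gm) (v, j) (v +
  (col j M + col j M), j).
  apply: connect_trans (stepu false v j) _; rewrite adj_sym.
  have := stepu true (v + (col j M + col j M)) j.
  by rewrite expr0 expr1 scale1r scaleN1r addrA addrK.
have stepc (v : 'cV['F_p]_r) (j : 'I_n) (c : 'F_p) : connect (@adjacent Gm)
  (v, j) (v + c *: col j M, j).
  have -> : c *: col j M = (col j M + col j M) *+ nat_of_ord (c / 2%:R).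
    rewrite -mulr2n -[RHS]scaler_nat -[col j M *+ 2]scaler_nat scalerA.
    by rewrite -Fp_natE divfK // Fp2_neq0.
  elim: (nat_of_ord _) => [|k IH]; first by rewrite mulr0n addr0.
  by apply: connect_trans IH _; rewrite mulrSr addrA.
have move (i j : 'I_n) : exists s : 'cV['F_p]_r, forall v : 'cV['F_p]_r,
  connect (@adjacent Gm) (v, i) (v + s, j).
  have [k ->] := iter_ordS_trans i j; elim: k => [|k [s IH]].
    by exists 0 => v; rewrite addr0.
  exists (s + (-1) ^+ false *: col (iter k (@ordS n) i) M) => v.
  by apply: connect_trans (IH v) _; rewrite addrA; apply: stepu.
have stepi (v : 'cV['F_p]_r) (j i : 'I_n) (c : 'F_p) : connect (@adjacent Gm)
  (v, j) (v + c *: col i M, j).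
  have [s Hs] := move j i; apply: connect_trans (Hs v) _.
  rewrite adj_sym; apply: connect_trans (Hs _) _; rewrite adj_sym addrAC.
  exact: stepc.
have stepw (v : 'cV['F_p]_r) (j : 'I_n) w : connect (@adjacent Gm) (v, j) (v +
  w, j).
  have /row_freeP[D MD] := row_free_gamma g_nz g_lt.
  have -> : w = \sum_i (D *m w) i 0 *: col i M.
    rewrite -[LHS]mul1mx -MD -mulmxA; apply/colP=> k; rewrite !mxE summxE.
    by apply: eq_bigr => i _; rewrite !mxE mulrC.
  elim/big_rec: _ v => [|i w' _ IH] v; first by rewrite addr0.
  by rewrite addrA; apply: connect_trans (stepi _ _ _ _) (IH _).
move=> [v i] [v' j]; have [s Hs] := move i j.
apply: connect_trans (Hs v) _.
by have := stepw (v + s) j (v' - (v + s)); rewrite subrKC.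
Qed.

(* Both sides lift the same morphism and agree at (0, i0).                    *)
Lemma lift_tr phi h w : h \in Aut_graph Gm -> is_lift (wp n_gt0 g) h phi ->
  let i0 := Ordinal n_gt0 in
  let w' := (vperm h (w, i0)).1 - (vperm h (0, i0)).1 in
  forall x, vperm h (trv w x) = trv w' (vperm h x).
Proof.
move=> Ah /is_liftP[hv hd] i0 w'.
pose a := comp_morph (aut_morph (tr_Aut w)) (aut_morph Ah).
pose b := comp_morph (aut_morph Ah) (aut_morph (tr_Aut w')).
have ab := @unique_lift _ _ _ (wp n_gt0 g) a b (0, i0) wp_inj Gamma_connected.
move=> x; rewrite -!vperm_tr; apply: (ab _ _ x) => [y|].
  change (mdart (wp n_gt0 g) (dperm h (dperm (tr w) y))
        = mdart (wp n_gt0 g) (dperm (tr w') (dperm h y))).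
  have /is_liftP[_ tr_d] := tr_lift w'; have /is_liftP[_ tr_d0] := tr_lift w.
  by rewrite tr_d dperm1 !hd tr_d0 dperm1.
rewrite /= !vperm_tr /trv /= add0r; have := hv (w, i0); have := hv (0, i0).
rewrite /w'; case: (vperm h (w, i0)) => a1 a2; case: (vperm h (0, i0)) => b1 b2.
by rewrite /= /wp_vert /= => -> ->; rewrite subrKC.
Qed.

(** The translation with the same value at x lifts the same automorphism, namely the identity, so
    uniqueness of lifts applies. *)
Lemma tr_unique h x y : h \in Aut_graph Gm -> is_lift (wp n_gt0 g) h 1%g ->
  vperm h x = y -> forall z, vperm h z = trv (y.1 - x.1) z.
Proof.
move=> Ah /is_liftP[hv hd] hx z.
pose b := aut_morph (tr_Aut (y.1 - x.1)).
have := @unique_lift _ _ _ (wp n_gt0 g) (aut_morph Ah) b x wp_inj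
          Gamma_connected.
move=> ab; rewrite -vperm_tr; apply: (ab _ _ z) => [d|].
  change (mdart (wp n_gt0 g) (dperm h d)
        = mdart (wp n_gt0 g) (dperm (tr (y.1 - x.1)) d)).
  have /is_liftP[_ tr_d] := tr_lift (y.1 - x.1).
  by rewrite tr_d hd.
rewrite /= vperm_tr; have := hv x; rewrite hx vperm1 /trv;
  case: (x) (y) => [a1 a2] [b1 b2].
by rewrite /= /wp_vert /= => ->; rewrite subrKC.
Qed.

End Translations.

Section StandardAutomorphisms.

Variables (p n : nat) (n_gt0 : (0 < n)%N) (g : {poly 'F_p}).
Notation r := (gamma_dim n g).
Notation M := (gamma_mx n g).
Notation Gm := (Gamma n_gt0 g).
Notation C := (doubled_cycle n_gt0).
Implicit Types (phi : vdperm C) (sg : 'I_n -> 'I_n) (e : 'I_n -> bool).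

(** Normal form of an automorphism: one direction bit for the whole cycle, and an edge index that is
    independent of the label. For n > 2 all automorphisms have it ([aut_std]); for n <= 2 loops can
    be inverted singly, or parallel edges permuted freely. *)
Definition std phi sg e (o : bool) : Prop :=
  forall (j : 'I_n) b t, dperm phi (j, b, t) = (sg j, b (+) e j, t (+) o).

Lemma std_inj phi sg e o : std phi sg e o -> injective sg.
Proof.
move=> Hs i j eq_ij.
have : dperm phi (i, e i, false) = dperm phi (j, e j, false).
  by rewrite !Hs !addbb eq_ij.
by case/perm_inj.
Qed.

Section LiftOfMatrix.

Variables (phi : vdperm C) (sg : 'I_n -> 'I_n) (e : 'I_n -> bool) (o : bool).
Variable A : 'M['F_p]_r.
Hypotheses (Aphi : phi \in Aut_graph C) (std_phi : std phi sg e o).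
Hypotheses (uA : A \in unitmx) (AM : A *m M = (-1) ^+ o *: sperm sg e M).

Lemma lift_col j : A *m col j M = ((-1) ^+ o * (-1) ^+ e j) *: col (sg j) M.
Proof. by rewrite colE mulmxA -colE AM linearZ /= col_sperm scalerA. Qed.

Definition liftv (x : vert Gm) : vert Gm := (A *m x.1, vperm phi x.2).

(** A dart is stored with the base point of its positive arc. When directions are reversed, the base
    point of the image is the image of the head, whence the shift by the voltage. *)
Definition liftd (x : dart Gm) : dart Gm :=
  let: (v, j, b, t) := x in
  (A *m (if o then v + (-1) ^+ b *: col j M else v),
   sg j, b (+) e j, t (+) o).

Lemma mulA_inj k : injective (mulmx A : 'M_(r, k) -> 'M_(r, k)).
Proof. by move=> u v uv; rewrite -[u](mulKmx uA) uv mulKmx. Qed.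

Lemma liftv_inj : injective liftv.
Proof. by move=> [u i] [v j] [/mulA_inj -> /perm_inj ->]. Qed.

Lemma liftd_inj : injective liftd.
Proof.
move=> [[[u i] b] t] [[[v j] c] s] [/mulA_inj uv /(std_inj std_phi) ij].
move=> bc /addIb ts; move: uv bc; rewrite ij ts => uv /addIb bc.
by move: uv; rewrite bc; case: o => [/addIr|] ->.
Qed.

Definition lift_perm : vdperm Gm := (perm liftv_inj, perm liftd_inj).

Lemma vperm_lift x : vperm lift_perm x = liftv x.
Proof. exact: permE. Qed.

Lemma dperm_lift x : dperm lift_perm x = liftd x.
Proof. exact: permE. Qed.

Lemma lift_perm_Aut : lift_perm \in Aut_graph Gm.
Proof.
have /Aut_graphP[phib _] := Aphi.
apply/Aut_graphP; split=> -[[[v j] b] t]; rewrite !dperm_lift ?vperm_lift;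
  last first.
  by rewrite /= addNb.
have := phib (j, b, t); rewrite std_phi; have := lift_col j.
rewrite /liftv /liftd /=; case: o t => [] [] /= Hc <-.
all: rewrite ?mulmxDr -?scalemxAr ?Hc ?signr_addb ?scalerA ?expr1 ?expr0
  ?mul1r //.
by rewrite mulN1r mulrN scaleNr subrK.
Qed.

Lemma lift_perm_lift : is_lift (wp n_gt0 g) lift_perm phi.
Proof.
apply/is_liftP; split=> [[v j]|[[[v j] b] t]]; first by rewrite vperm_lift.
by rewrite dperm_lift /= std_phi.
Qed.

End LiftOfMatrix.

Hypotheses (p_prime : prime p) (p_odd : odd p).
Hypotheses (g_nz : g != 0) (g_lt : ((size g).-1 < n)%N).

(** The matrix expresses the permuted rows through the original ones; it is invertible because a
    signed permutation of columns keeps the rank full. *)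
Lemma preserves_mx sg e o : injective sg -> preserves sg e g ->
  exists2 A : 'M['F_p]_r, A \in unitmx & A *m M = (-1) ^+ o *: sperm sg e M.
Proof.
move=> sg_inj pres; have free := row_free_gamma g_nz g_lt.
have /submxP[A AM] : (sperm sg e M <= M)%MS.
  by apply: sperm_sub => v; rewrite !sub_gamma //; apply: pres.
exists ((-1) ^+ o *: A); last by rewrite -scalemxAl -AM.
rewrite unitmxZ ?unitfE ?signr_eq0 // -row_free_unit.
rewrite /row_free eqn_leq rank_leq_row /=.
have := row_free_sperm e sg_inj free; rewrite /row_free AM => /eqP rk.
by rewrite -[X in (X <= _)%N]rk mxrankM_maxl.
Qed.

(** A matrix with [A *m M] equal to the signed permutation of [M], up to the global sign of [o],
    gives the lift [liftv]. Conversely, a lift carries translations to translations ([lift_tr]),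
    which defines an additive map, linear over the prime field; its effect on the closed walks of
    voltage 2 u_j gives the matrix identity after cancelling 2. *)
Lemma lifts_preserves phi sg e o : phi \in Aut_graph C -> std phi sg e o ->
  phi \in lifting_set (wp n_gt0 g) <-> preserves sg e g.
Proof.
move=> Aphi std_phi; have free := row_free_gamma g_nz g_lt; split; last first.
  move/(preserves_mx o (std_inj std_phi)) => [A uA AM].
  rewrite inE Aphi; apply/exists_inP; exists (lift_perm std_phi uA).
    exact: lift_perm_Aut.
  exact: lift_perm_lift.
case/setIdP=> _ /exists_inP[h Ah lift_h]; have /is_liftP[hv hd] := lift_h.
pose i0 := Ordinal n_gt0.
pose a (w : 'cV['F_p]_r) := (vperm h (w, i0)).1 - (vperm h (0, i0)).1.
have htr w x : vperm h (trv w x) = trv (a w) (vperm h x).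
  exact: (lift_tr p_prime p_odd g_nz g_lt w Ah lift_h).
have aD : {morph a : u v / u + v}.
  move=> u v; have := htr v (u, i0); rewrite /trv /= => E.
  by rewrite /a E /= addrAC.
have a0 : a 0 = 0 by rewrite /a subrr.
have aMn u k : a (u *+ k) = a u *+ k.
  by elim: k => [|k IH]; rewrite ?mulr0n // !mulrSr aD IH.
have aZ c u : a (c *: u) = c *: a u.
  by rewrite [c]Fp_natE !scaler_nat aMn.
pose A : 'M['F_p]_r := \matrix_(i, k) a (delta_mx k 0) i 0.
have aE u : a u = A *m u.
  rewrite {1}[u]matrix_sum_delta.
  under eq_bigr do rewrite big_ord1.
  have -> : a (\sum_i u i 0 *: delta_mx i 0) = \sum_i u i 0 *: a (delta_mx i 0).
    by rewrite (big_morph a aD a0); apply: eq_bigr => i _; rewrite aZ.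
  apply/colP=> i; rewrite summxE mxE; apply: eq_bigr => k _.
  by rewrite !mxE mulrC.
(* 2 u_j is the voltage of the closed walk a_j b_j^-1. *)
have a2 j : a (col j M + col j M)
    = (-1) ^+ (o (+) e j) *: (col (sg j) M + col (sg j) M).
  pose x : dart Gm := (0, j, false, false).
  pose y : dart Gm := (col j M + col j M, j, true, false).
  have /Aut_graphP[hb hi] := Ah.
  have bx : beg x = (0, j) by [].
  have by_ : beg y = trv (col j M + col j M) (0, j) by rewrite /trv /= add0r.
  have xy : beg (Defs.inv x) = beg (Defs.inv y).
    by rewrite /= expr0 expr1 scale1r scaleN1r add0r addrK.
  have hxy : beg (Defs.inv (dperm h x)) = beg (Defs.inv (dperm h y)).
    by rewrite !hi !hb xy.
  have := hb y; rewrite by_ htr -bx -hb.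
  have := hd x; have := hd y; rewrite /= !std_phi.
  move: hxy; case: (dperm h x) => [[[v1 j1] b1] t1].
  case: (dperm h y) => [[[v2 j2] b2] t2] /= hxy [Ej2 Eb2 Et2] [Ej1 Eb1 Et1].
  move: hxy; rewrite Ej1 Eb1 Et1 Ej2 Eb2 Et2 /trv !signrN.
  set w := a _; set c := _ *: col (sg j) M.
  case: (o) => /= hxy [/esym E].
    move: hxy => [v12]; move: E; rewrite v12 -addrA => /addrI.
    move/(canRL (addKr c)) ->; rewrite !signrN.
    by rewrite !scaleNr scalerDr -/c opprD.
  move: hxy; rewrite -E => -[]; rewrite -addrA => /addrI.
  move/esym/(canRL (addrK _)) ->; rewrite scaleNr opprK.
  by rewrite scalerDr.
have AM : A *m M = (-1) ^+ o *: sperm sg e M.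
  apply/matrixP=> i j; have /colP/(_ i) := a2 j.
  have -> : col j M + col j M = 2%:R *: col j M by rewrite scaler_nat mulr2n.
  have -> : col (sg j) M + col (sg j) M = 2%:R *: col (sg j) M.
    by rewrite scaler_nat mulr2n.
  rewrite aZ aE scalerA mulrC -scalerA !mxE => /(mulfI (Fp2_neq0 p_prime
    p_odd)).
  rewrite signr_addb mulrA => <-; apply: eq_bigr => k _; by rewrite !mxE.
move=> v; rewrite -!(sub_gamma g_nz g_lt) => /submxP[y ->].
rewrite sperm_mul; have -> : sperm sg e M = (-1) ^+ o *: (A *m M).
  by rewrite AM scalerA -expr2 sqrr_sign scale1r.
by rewrite -scalemxAr scalemx_sub // mulmxA submxMl.
Qed.

End StandardAutomorphisms.

(** * Automorphisms of the doubled cycle *)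

Section CycleAutomorphisms.

Variables (n : nat) (n_gt0 : (0 < n)%N).
Notation C := (doubled_cycle n_gt0).
Implicit Types (phi : vdperm C) (sg : 'I_n -> 'I_n) (e s : 'I_n -> bool).

Definition stdd sg e o (x : dart C) : dart C :=
  let: (j, b, t) := x in (sg j, b (+) e j, t (+) o).

Lemma stdd_inj sg e o : injective sg -> injective (stdd sg e o).
Proof.
move=> sgI [[i b] t] [[j c] u] [/sgI ->].
by move=> /addIb -> /addIb ->.
Qed.

Definition std_aut (nu : {perm 'I_n}) sg (sgI : injective sg) e o : vdperm C :=
  (nu, perm (@stdd_inj sg e o sgI)).

Lemma std_std_aut nu sg (sgI : injective sg) e o : std (std_aut nu sgI e o) sg
  e o.
Proof. by move=> j b t; apply: permE. Qed.

Lemma aut_eq phi psi : phi \in Aut_graph C -> psi \in Aut_graph C ->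
  dperm phi =1 dperm psi -> phi = psi.
Proof.
move=> /Aut_graphP[bphi _] /Aut_graphP[bpsi _] eqd.
rewrite [phi]surjective_pairing [psi]surjective_pairing; congr (_, _).
  apply/permP=> j; have := bphi (j, false, false); rewrite eqd bpsi.
  by move/esym.
exact/permP.
Qed.

Lemma ordS_rev (j : 'I_n) : ordS (rev_ord (ordS j)) = rev_ord j.
Proof.
apply: val_inj => /=; have lt_j := ltn_ord j.
have [lt_j1|ge_j1] := ltnP j.+1 n.
  by rewrite (modn_small lt_j1) subnSK // modn_small //; lia.
have -> : j.+1 = n by lia.
by rewrite modnn subn1 prednK // modnn subnn.
Qed.

Lemma rev_ordS (j : 'I_n) : rev_ord (ordS j) = ord_pred (rev_ord j).
Proof.
by apply: (can_inj (@ordSK n)); rewrite ordS_rev ord_predK.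
Qed.

Lemma ord_pred_rev (j : 'I_n) : ord_pred (rev_ord (ord_pred j)) = rev_ord j.
Proof.
by rewrite -rev_ordS ord_predK.
Qed.

(** Labels are exchanged only where the coordinates wrap around, which accounts for x^n being
    (-1)^eps modulo Delta. *)
Definition rot_sign (eps : bool) (j : 'I_n) := eps && (j == 0 :> nat).

Definition rotation eps :=
  std_aut (perm (@ord_pred_inj n)) (@ord_pred_inj n) (rot_sign eps) false.

Definition flips s := std_aut 1 (@inj_id 'I_n) s false.

(** The vertex map is j -> -j; the edge index j, between j and j + 1, goes to -j - 1, which is
    [rev_ord]. *)
Definition reflection e :=
  std_aut (perm (inj_comp (@ordS_inj n) (@rev_ord_inj n))) (@rev_ord_inj n) e
    true.

Lemma rotation_std eps : std (rotation eps) (@ord_pred n) (rot_sign eps) false.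
Proof. exact: std_std_aut. Qed.

Lemma flips_std s : std (flips s) id s false.
Proof. exact: std_std_aut. Qed.

Lemma reflection_std e : std (reflection e) (@rev_ord n) e true.
Proof. exact: std_std_aut. Qed.

Lemma rotation_Aut eps : rotation eps \in Aut_graph C.
Proof.
apply/Aut_graphP; split=> -[[j b] t]; rewrite !std_std_aut //= ?addbF //.
by case: t; rewrite /vperm permE //= ord_predK ordSK.
Qed.

Lemma flips_Aut s : flips s \in Aut_graph C.
Proof.
apply/Aut_graphP; split=> -[[j b] t]; rewrite !std_std_aut //= ?addbF //.
by rewrite /vperm perm1.
Qed.

Lemma reflection_Aut e : reflection e \in Aut_graph C.
Proof.
apply/Aut_graphP; split=> -[[j b] t]; rewrite !std_std_aut //= ?addbT //.
by case: t; rewrite /vperm permE //= ordS_rev.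
Qed.

Lemma flips_conj eps s :
  (flips s ^ rotation eps)%g = flips (fun j => s (ordS j)).
Proof.
apply: (mulgI (rotation eps)); rewrite -conjgC.
apply: aut_eq; rewrite ?groupM ?rotation_Aut ?flips_Aut //.
move=> [[j b] t]; rewrite !dpermM !std_std_aut ord_predK.
by congr (_, _, _); rewrite addbAC.
Qed.

(** The dihedral relation up to the flip of neighbouring differences of [e]: both rotations
    contribute their sign at j = 0, so [eps] cancels. *)
Lemma reflection_rotation eps e :
  (rotation eps * reflection e * rotation eps
    = flips (fun j => e j (+) e (ord_pred j)) * reflection e)%g.
Proof.
apply: aut_eq; rewrite ?groupM ?rotation_Aut ?flips_Aut ?reflection_Aut //.
move=> [[j b] t]; rewrite !dpermM !std_std_aut ord_pred_rev.
congr (_, _, _); last by case: t.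
rewrite /rot_sign.
have -> : (rev_ord (ord_pred j) == 0 :> nat) = (j == 0 :> nat).
  rewrite -[rev_ord _]ord_predK ord_pred_rev /= subnSK //.
  have [->|j_gt0] := posnP (nat_of_ord j); first by rewrite subn0 modnn.
  have lt_j := ltn_ord j.
  by rewrite modn_small; [apply/eqP/eqP; lia|lia].
by case: b (e j) (e (ord_pred j)) (_ && _) => [] [] [] [].
Qed.

Lemma std_mul phi psi sg e o sg' e' o' : std phi sg e o -> std psi sg' e' o' ->
  std (phi * psi)%g (sg' \o sg) (fun j => e j (+) e' (sg j)) (o (+) o').
Proof. by move=> H1 H2 j b t; rewrite dpermM H1 H2 !addbA. Qed.

Hypothesis n_gt2 : (2 < n)%N.

Lemma ordS2_neq (j : 'I_n) : ordS (ordS j) <> j.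
Proof.
move=> /(congr1 val) /=; have lt_j := ltn_ord j.
rewrite -addn1 modnDml addn1 => E.
have : (j.+2 %% n == j %% n)%N by rewrite E modn_small.
by rewrite -addn2 -{2}[val j]addn0 eqn_modDl mod0n modn_small.
Qed.

(** As n > 2, two darts over the same ends have the same index and direction, so both darts from j
    to j + 1 move together. The direction cannot change from one edge to the next, since j and j + 2
    would then have the same image. *)
Lemma aut_std phi : phi \in Aut_graph C ->
  exists sg e o, std phi sg e o /\
    forall j, sg (ordS j) = if o then ord_pred (sg j) else ordS (sg j).
Proof.
move=> /Aut_graphP[bphi iphi].
pose x j b : dart C := dperm phi (j, b, false).
pose sg j := (x j false).1.1; pose o j := (x j false).2.
have endx j b : beg (Defs.inv (x j b)) = vperm phi (ordS j).
  by rewrite /x iphi bphi.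
have begx j b : beg (x j b) = vperm phi j by rewrite /x bphi.
have xE j b : (x j b).1.1 = sg j /\ (x j b).2 = o j.
  have := begx j b; have := endx j b; rewrite -(begx j false) -(endx j false).
  rewrite /sg /o; case: (x j b) => [[i c] t];
    case: (x j false) => [[i' c'] t'] /=.
  case: t t' => [] [] //= E1 E2; rewrite ?E1 ?E2 //.
    by case: (@ordS2_neq i'); rewrite -E1.
  by case: (@ordS2_neq i); rewrite E1.
have vsg j : vperm phi j = if o j then ordS (sg j) else sg j.
  by rewrite -(begx j false) /sg /o; case: (x j false) => [[i c] t].
have vsgS j : vperm phi (ordS j) = if o j then sg j else ordS (sg j).
  rewrite -(endx j false) /sg /o; case: (x j false) => [[i c] t] /=.
  by case: t.
have o_next j : o (ordS j) = o j.
  have vinj : injective (vperm phi) by apply: perm_inj.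
  have := vsg j; have := vsgS j; have := vsgS (ordS j); have := vsg (ordS j).
  case: (o j) (o (ordS j)) => [] [] // -> E3.
    by move=> E2 E1; case: (@ordS2_neq j); apply: vinj; rewrite E3 E2 E1.
  move=> /ordS_inj E2 E1; case: (@ordS2_neq j); apply: vinj.
  by rewrite E3 E2 E1.
have oE j : o j = o (Ordinal n_gt0).
  by have [k ->] := iter_ordS_trans (Ordinal n_gt0) j; elim: k => //= k <-.
set oo := o (Ordinal n_gt0) in oE.
exists sg, (fun j => (x j false).1.2), oo; split; last first.
  move=> j; have := vsg (ordS j); rewrite vsgS !oE.
  by case: oo {oE} => // ->; rewrite ordSK.
have xb j b : x j b = (sg j, b (+) (x j false).1.2, oo).
  have neq : x j false <> x j true by move/perm_inj.
  have := xE j b; have := xE j false; have := xE j true; rewrite oE.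
  move: neq; case: b; case: (x j false) => [[i c] t];
    case: (x j true) => [[i' c'] t'] /=.
    move=> neq [E3 E4] [E1 E2] _; move: neq; rewrite E1 E2 E3 E4.
    by case: c c' => [] [] // /(_ erefl).
  by move=> _ _ [-> ->] _.
move=> j b [] /=; last exact: xb.
have := iphi (j, b, false); rewrite /= -/(x j b) xb /= => <-.
by [].
Qed.

Lemma std_rotation phi sg e o eps k : phi \in Aut_graph C -> std phi sg e o ->
    (forall j, sg (ordS j) = if o then ord_pred (sg j) else ordS (sg j)) ->
  exists e', let sg' := fun j => iter k (@ord_pred n) (sg j) in
    std (phi * rotation eps ^+ k)%g sg' e' o /\
    (forall j, sg' (ordS j) = if o then ord_pred (sg' j) else ordS (sg' j)).
Proof.
move=> Aphi std_phi step; elim: k => [|k [e' [IH1 IH2]]].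
  by exists e; rewrite mulg1.
exists (fun j => e' j (+) rot_sign eps (iter k (@ord_pred n) (sg j))); split.
  have := std_mul IH1 (@std_std_aut (perm (@ord_pred_inj n)) _ (@ord_pred_inj n)
                         (rot_sign eps) false).
  by rewrite expgSr mulgA addbF.
move=> j; rewrite !iterS IH2; case: (o) => //.
by rewrite ord_predK ordSK.
Qed.

(** A power of the rotation brings the image of edge index 0 to its place under a flip or a
    reflection; the step relation then determines all other indices. *)
Lemma aut_cases phi eps : phi \in Aut_graph C ->
  exists k, (exists s, phi * rotation eps ^+ k = flips s)%g \/
            (exists e, phi * rotation eps ^+ k = reflection e)%g.
Proof.
move=> Aphi; have [sg [e [o [std_phi step]]]] := aut_std Aphi.
pose i0 := Ordinal n_gt0.
have [k Hk] := iter_ordS_trans (if o then rev_ord i0 else i0) (sg i0).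
have sg0 : iter k (@ord_pred n) (sg i0) = if o then rev_ord i0 else i0.
  by rewrite Hk; elim: k {Hk} => // k IH; rewrite iterSr iterS ordSK.
have [e' [std' step']] := std_rotation eps k Aphi std_phi step.
have Ak : (phi * rotation eps ^+ k)%g \in Aut_graph C.
  by rewrite groupM ?groupX ?rotation_Aut.
exists k; case: o std' step' sg0 {std_phi step Hk} => std' step' sg0.
  right; exists e'; apply: aut_eq => //; first exact: reflection_Aut.
  move=> [[j b] t]; rewrite std_std_aut std'; congr (_, _, _).
  have [m ->] := iter_ordS_trans i0 j; elim: m => // m IH.
  by rewrite !iterS step' IH rev_ordS.
left; exists e'; apply: aut_eq => //; first exact: flips_Aut.
move=> [[j b] t]; rewrite std_std_aut std'; congr (_, _, _).
have [m ->] := iter_ordS_trans i0 j; elim: m => // m IH.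
by rewrite !iterS step' IH.
Qed.

End CycleAutomorphisms.

(** * The lifting group of a divisor *)

Section LiftingGroup.

Variables (p n : nat) (n_gt0 : (0 < n)%N) (eps : bool).
Notation C := (doubled_cycle n_gt0).
Notation lifts g := (lifting_group (wp n_gt0 g)).
Implicit Types (g h : {poly 'F_p}) (s e : 'I_n -> bool).

Lemma rVpoly_sperm_id s (st : nat -> 'F_p) (v : 'rV_n) :
  (forall j : 'I_n, st j = (-1) ^+ s j) ->
  rVpoly (sperm id s v) = twist st (rVpoly v).
Proof.
move=> stE; apply/polyP=> i; rewrite coef_twist.
case: (ltnP i n) => [lt_i|ge_i];
  last by rewrite !nth_default ?mulr0 ?(leq_trans (size_poly _ _)).
by rewrite -[i]/(nat_of_ord (Ordinal lt_i)) !coef_rVpoly_ord mxE stE.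
Qed.

Lemma rVpoly_sperm_rev s (st : nat -> 'F_p) (v : 'rV_n) :
  (forall j : 'I_n, st j = (-1) ^+ s j) ->
  rVpoly (sperm (@rev_ord n) s v) = twist st (revp n (rVpoly v)).
Proof.
move=> stE; apply/polyP=> i; rewrite coef_twist coef_revp.
case: (ltnP i n) => [lt_i|ge_i].
  rewrite -[i]/(nat_of_ord (Ordinal lt_i)) !coef_rVpoly_ord mxE stE.
  have -> : (n.-1 - Ordinal lt_i)%N = rev_ord (Ordinal lt_i) by rewrite /=; lia.
  by rewrite coef_rVpoly_ord.
by rewrite nth_default ?mulr0 ?(leq_trans (size_poly _ _)).
Qed.

(** Multiplication by x modulo Delta: the overflow at x^n is removed by a multiple of Delta. *)
Lemma rVpoly_sperm_pred (v : 'rV_n) :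
  rVpoly (sperm (@ord_pred n) (rot_sign eps) v)
    = 'X * rVpoly v - (rVpoly v)`_n.-1 *: Delta p n eps.
Proof.
apply/polyP=> i; rewrite coefB coefXM coefZ coefB coefXn coefC.
have [->|i_gt0] := posnP i.
  rewrite -[0%N in LHS]/(nat_of_ord (Ordinal n_gt0)) coef_rVpoly_ord mxE /=.
  rewrite /rot_sign /= andbT sub0r (ltn_eqF n_gt0) sub0r mulrN opprK mulrC.
  congr (_ * _); have E : n.-1 = ord_pred (Ordinal n_gt0) :> nat.
    by rewrite /= add0n modn_small // prednK.
  by rewrite [in RHS]E coef_rVpoly_ord.
rewrite /= subr0; case: (ltngtP i n) => [lt_i|gt_i|eq_i].
- rewrite mulr0 subr0 -{1}[i]/(nat_of_ord (Ordinal lt_i)) coef_rVpoly_ord mxE.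
  rewrite /rot_sign /= gtn_eqF // andbF mul1r.
  have E : i.-1 = ord_pred (Ordinal lt_i) :> nat.
    rewrite /=; have -> : (i + n).-1 = (i.-1 + n)%N by lia.
    by rewrite modnDr modn_small //; lia.
  by rewrite [in RHS]E coef_rVpoly_ord.
- rewrite mulr0 subr0 !nth_default // (leq_trans (size_poly _ _)) //; lia.
by rewrite eq_i mulr1 subrr nth_default // size_poly.
Qed.

Hypotheses (p_prime : prime p) (p_odd : odd p).

Section OneDivisor.

Variable g : {poly 'F_p}.
Hypothesis g_div : proper_divisor n eps g.

Let g_mon : g \is monic. Proof. by case: g_div. Qed.
Let g_dvd : g %| Delta p n eps. Proof. by case: g_div. Qed.
Let g_lt : ((size g).-1 < n)%N. Proof. by case: g_div. Qed.
Let g_nz : g != 0. Proof. exact: monic_neq0. Qed.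
Let g0 : g`_0 != 0. Proof. exact: dvd_Delta_coef0 g_dvd. Qed.
Let size_g : (size g <= n)%N.
Proof.
by rewrite -(prednK (n := size g)) // lt0n size_poly_eq0.
Qed.

Lemma lifts_stdP phi sg e o : phi \in Aut_graph C -> std phi sg e o ->
  phi \in lifts g <-> preserves sg e g.
Proof. exact: lifts_preserves. Qed.

Lemma rotation_lifts : rotation n_gt0 eps \in lifts g.
Proof.
apply/(lifts_stdP (rotation_Aut _ _) (rotation_std _ _)) => v gv.
by rewrite rVpoly_sperm_pred -mul_polyC dvdp_sub ?dvdp_mull.
Qed.

Lemma flips_liftsP s : flips n_gt0 s \in lifts g <-> preserves id s g.
Proof. exact: lifts_stdP (flips_Aut _ _) (flips_std _ _). Qed.

Lemma reflection_liftsP e :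
  reflection n_gt0 e \in lifts g <-> preserves (@rev_ord n) e g.
Proof. exact: lifts_stdP (reflection_Aut _ _) (reflection_std _ _). Qed.

(** Extended periodically, the signs do not see shifts by exponents of g, so twisting q g only
    twists q. *)
Lemma flips_lifts d s : (0 < d)%N -> (d %| n)%N ->
    (forall i, g`_i != 0 -> (d %| i)%N) ->
    (forall i j : 'I_n, i = j %[mod d] -> s i = s j) ->
  flips n_gt0 s \in lifts g.
Proof.
move=> d_gt0 dn supp per.
have lt_mod k : (k %% d < n)%N.
  exact: leq_trans (ltn_pmod _ d_gt0) (dvdn_leq n_gt0 dn).
pose st k : 'F_p := (-1) ^+ s (Ordinal (lt_mod k)).
apply/flips_liftsP => v /dvdpP[q defv].
rewrite (@rVpoly_sperm_id _ st) => [|j]; last first.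
  rewrite /st; congr (_ ^+ _); congr (nat_of_bool _); apply: per.
  by rewrite /= modn_mod.
rewrite defv (twistM (u := fun _ => 1)) => [|i j /supp di]; last first.
  rewrite mulr1 /st; congr (_ ^+ _); congr (nat_of_bool _); apply: per => /=.
  by rewrite !modn_mod; case/dvdnP: di => k ->; rewrite addnC modnMDl.
by rewrite (twist_id (s := fun _ => 1) (f := g)) // dvdp_mulIr.
Qed.

Lemma signr_Fp_inj (a b : bool) : (-1) ^+ a = (-1) ^+ b :> 'F_p -> a = b.
Proof.
case: a b => [] [] // /eqP; rewrite ?expr1 ?expr0 1?[-1 == 1]eq_sym -addr_eq0.
  by move=> /eqP/(Fp_double_eq0 p_prime p_odd)/eqP; rewrite oner_eq0.
by move=> /eqP/(Fp_double_eq0 p_prime p_odd)/eqP; rewrite oner_eq0.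
Qed.

(** The default 1 keeps all values nonzero, so that twisting preserves sizes. *)
Definition sign_ext s (k : nat) : 'F_p :=
  if insub k is Some j then (-1) ^+ s j else 1.

Lemma sign_extE s (j : 'I_n) : sign_ext s j = (-1) ^+ s j.
Proof. by rewrite /sign_ext valK. Qed.

Lemma sign_ext_neq0 s k : sign_ext s k != 0.
Proof. by rewrite /sign_ext; case: insub => [j|];
  rewrite ?signr_eq0 ?oner_eq0. Qed.

(* The image of g has degree at most deg g, hence is a scalar multiple of g.  *)
Lemma flips_supp s : flips n_gt0 s \in lifts g ->
  forall i : 'I_n, g`_i != 0 -> s i = s (Ordinal n_gt0).
Proof.
move/flips_liftsP => pres i gi.
have := pres (poly_rV g);
  rewrite (rVpoly_sperm_id _ (sign_extE s)) poly_rV_K //.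
move=> /(_ (dvdpp _)) dv.
have /eqpf_eq[c _ defc] : twist (sign_ext s) g %= g.
  by rewrite eqp_sym -dvdp_size_eqp // size_twist // => k; apply: sign_ext_neq0.
have key (j : 'I_n) : g`_j != 0 -> (-1) ^+ s j = c.
  move=> gj; move/polyP/(_ j): defc; rewrite coef_twist coefZ sign_extE.
  exact: mulIf.
by apply: signr_Fp_inj; rewrite !key.
Qed.

Lemma flips_shift s k : flips n_gt0 s \in lifts g ->
  flips n_gt0 (fun j => s (iter k (@ordS n) j)) \in lifts g.
Proof.
elim: k s => [|k IH] s // Gs.
have := groupJ Gs rotation_lifts; rewrite flips_conj => /IH.
by [].
Qed.

(** Applying [flips_supp] to the conjugates by rotations makes every exponent of g a period of s,
    besides n. All periods are multiples of the least one, t; hence t is in exp(g), or divides n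
    when g = 1, and so divides [Exp n g]. *)
Lemma flips_periodic s : flips n_gt0 s \in lifts g ->
  forall i j : 'I_n, i = j %[mod Exp n g] -> s i = s j.
Proof.
move=> Gs; pose S m := s (Ordinal (ltn_pmod m n_gt0)).
have Smod m m' : m = m' %[mod n] -> S m = S m'.
  by move=> E; congr (s _); apply: val_inj.
pose per t := [forall m : 'I_n, S (m + t)%N == S m].
have perP t : per t -> forall m, S (m + t)%N = S m.
  move=> /forallP H m; have /eqP := H (Ordinal (ltn_pmod m n_gt0)).
  rewrite (Smod _ (m + t)%N) => [->|]; last by rewrite /= modnDml.
  by apply: Smod; rewrite /= modn_mod.
have mkper t : (forall m, S (m + t)%N = S m) -> per t.
  by move=> H; apply/forallP=> m; rewrite H.
have per_n : per n by apply: mkper => m; apply: Smod; rewrite modnDr.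
have per_supp i : g`_i != 0 -> per i.
  move=> gi; have lt_i : (i < n)%N.
    by apply: leq_trans size_g; rewrite ltnNge;
      apply: contra gi => /leq_sizeP->.
  apply: mkper => m.
  have := flips_supp (flips_shift m Gs) (i := Ordinal lt_i) gi.
  rewrite /S => E; transitivity (s (iter m (@ordS n) (Ordinal lt_i))).
    by congr (s _); apply: val_inj; rewrite /= iter_ordS addnC.
  by rewrite E; congr (s _); apply: val_inj; rewrite /= iter_ordS add0n.
have exP : exists t, (0 < t)%N && per t by exists n; rewrite n_gt0.
case: (ex_minnP exP) => t /andP[t_gt0 per_t] min_t.
have perM k : forall m, S (m + k * t)%N = S m.
  elim: k => [|k IH] m; first by rewrite mul0n addn0.
  by rewrite mulSn addnA IH perP.
have dvd_per k : per k -> (t %| k)%N.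
  move=> per_k; rewrite /dvdn -leqn0 leqNgt; apply/negP=> mod_gt0.
  have : (t <= k %% t)%N.
    apply: min_t; rewrite mod_gt0; apply: mkper => m.
    by rewrite -(perM (k %/ t)%N) -addnA [(k %% t + _)%N]addnC -divn_eq perP.
  by rewrite leqNgt ltn_pmod.
have tE : (t %| Exp n g)%N.
  case: (leqP (size g) 1) => [/(Exp_const n)->|g_gt1]; first exact: dvd_per.
  by apply: in_exp_dvd_Exp => //; apply/in_exp_suppP => // i /per_supp/dvd_per.
have Si (i : 'I_n) : s i = S i by congr (s _); apply: val_inj;
  rewrite /= modn_small.
have Smodt m : S m = S (m %% t)%N.
  by rewrite {1}(divn_eq m t) addnC perM.
move=> i j Eij; rewrite !Si Smodt [RHS]Smodt -(modn_dvdm i tE) Eij.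
by rewrite modn_dvdm.
Qed.

Lemma associated_size : size g = ((size (associated n g)).-1 * Exp n g).+1.
Proof.
rewrite {1}(associated_monicE n g_mon) size_comp_Xn ?Exp_gt0 //.
apply: contraNneq g_nz => a0; rewrite (associated_monicE n g_mon) a0.
by rewrite comp_poly0.
Qed.

(** Reversing and twisting q g acts on each factor, and on g it gives a scalar multiple of g by
    reflexibility. *)
Lemma reflection_lifts b a d : (0 < d)%N -> g = a \Po 'X^d -> refl b a ->
  reflection n_gt0 (fun j => b && odd (j %/ d)) \in lifts g.
Proof.
move=> d_gt0 gE ra; have a_nz : a != 0.
  by apply: contraNneq g_nz => a0; rewrite gE a0 comp_poly0.
have [l l_nz] := refl_comp d_gt0 a_nz ra; rewrite -gE => defl.
pose st i := alt p b (i %/ d).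
have supp i : g`_i != 0 -> (d %| i)%N.
  by rewrite gE coef_comp_poly_Xn //; case: ifP; rewrite ?eqxx.
apply/reflection_liftsP => v /dvdpP[q defv].
rewrite (@rVpoly_sperm_rev _ st) => [|j]; last first.
  by rewrite /st /alt; case: (b); rewrite ?mul1n ?mul0n //= signr_odd.
have g_gt0 : (0 < size g)%N by rewrite lt0n size_poly_eq0.
have sq : (size q <= (n - size g).+1)%N.
  have -> : (n - size g).+1 = gamma_dim n g by rewrite /gamma_dim; lia.
  by apply: size_quotient; rewrite -?defv ?size_poly.
have nE : n = ((n - size g) + (size g).-1).+1 by lia.
rewrite defv [X in revp X _]nE revpM //; last by rewrite prednK.
rewrite prednK // -(dvdpZr _ _ l_nz) -twistZ scalerAr defl (twistM (u := st)).
  rewrite twistK ?dvdp_mulIr // => i; exact: alt_sqr.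
move=> i j; rewrite coef_twist mulf_eq0 => /norP[_ /supp di].
by rewrite /st divnDr // altD.
Qed.

(* Comparing the reflection with its conjugates by the rotation shows that    *)
(* the signs e_j + e_(j-1) are d-periodic, so that e_(kd) = e_0 + k b.        *)
Lemma reflection_refl e : reflection n_gt0 e \in lifts g ->
  exists b, refl b (associated n g).
Proof.
case: (leqP (size g) 1) => [/(monic_size1 g_mon) g1 _|g_gt1 Ge].
  by rewrite g1; apply/weakly_reflexibleP; [apply: monic1|left].
have d_gt0 := Exp_gt0 g n_gt0; have dn := Exp_dvdn n_gt0 g_div.
have gE := associated_monicE n g_mon; have sg := associated_size.
have a_gt1 := associated_size_gt1 n g_gt1.
have per : forall i j : 'I_n, i = j %[mod Exp n g] ->
    e i (+) e (ord_pred i) = e j (+) e (ord_pred j).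
  apply: (flips_periodic (s := fun j => e j (+) e (ord_pred j))).
  have -> : flips n_gt0 (fun j => e j (+) e (ord_pred j))
          = (rotation n_gt0 eps * reflection n_gt0 e * rotation n_gt0 eps
             * (reflection n_gt0 e)^-1)%g.
    by rewrite reflection_rotation mulgK.
  by rewrite !groupM ?groupV ?rotation_lifts.
set d := Exp n g in d_gt0 dn gE sg per *;
  set a := associated n g in gE sg a_gt1 *.
pose E m := e (Ordinal (ltn_pmod m n_gt0)).
have EE (j : 'I_n) : E j = e j.
  by congr (e _); apply: val_inj; rewrite /= modn_small.
have perE m : (m.+1 + d < n)%N ->
    E (m.+1 + d)%N (+) E (m + d)%N = E m.+1 (+) E m.
  move=> lt_m; have lt_m1 : (m.+1 < n)%N by lia.
  have := per (Ordinal lt_m) (Ordinal lt_m1); rewrite -!EE /= modnDr.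
  move=> /(_ erefl).
  have -> : ((m.+1 + d + n).-1 %% n = m + d)%N.
    have -> : ((m.+1 + d + n).-1 = m + d + n)%N by lia.
    by rewrite modnDr modn_small //; lia.
  have -> : ((m.+1 + n).-1 %% n = m)%N.
    have -> : ((m.+1 + n).-1 = m + n)%N by lia.
    by rewrite modnDr modn_small //; lia.
  by [].
pose b := E d (+) E 0%N.
have stepE m : (m + d < n)%N -> E (m + d)%N = E m (+) b.
  elim: m => [|m IH] lt_m; first by rewrite add0n /b addbCA addbb addbF.
  have := perE m lt_m; rewrite IH; last exact: ltnW lt_m.
  by case: (E (m.+1 + d)%N) (E m) (E m.+1) (b) => [] [] [] [].
have blockE k : (k * d < n)%N -> E (k * d)%N = E 0%N (+) (b && odd k).
  elim: k => [|k IH] lt_k; first by rewrite mul0n /= andbF addbF.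
  move: lt_k; rewrite mulSn addnC => lt_k; rewrite stepE // IH; last first.
    exact: leq_ltn_trans (leq_addr d _) lt_k.
  by rewrite /=; case: (E 0%N) (b) (odd k) => [] [] [].
exists b.
have /reflection_liftsP pres := Ge.
pose st := sign_ext e.
(* Test on the multiple x^(n - size g) g of degree n - 1: its reversal is that of g alone, of the
   same size as g, so divisibility by g leaves only a scalar. *)
have [c c_nz defc] : exists2 c, c != 0 & twist st (revp (size g) g) = c *: g.
  apply/eqpf_eq; rewrite eqp_sym -dvdp_size_eqp; last first.
    have g_gt0 : (0 < size g)%N by rewrite lt0n size_poly_eq0.
    have nE : n = ((n - size g) + (size g).-1).+1 by lia.
    have := pres (poly_rV ('X^(n - size g) * g)).
    rewrite (rVpoly_sperm_rev _ (sign_extE e)) poly_rV_K; last first.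
      apply: leq_trans (size_polyMleq _ _) _.
      by rewrite size_polyXn addSn /= subnK.
    move=> /(_ (dvdp_mulIr _ _));
      rewrite [X in revp X _]nE revpM ?size_polyXn // prednK //.
    have -> : revp (n - size g).+1 'X^(n - size g) = 1 :> {poly 'F_p}.
      apply/polyP=> i; rewrite coef_revp coefXn coef1 /=;
        case: ltnP => [le_i|gt_i].
        by congr (_%:R); congr (nat_of_bool _); apply/eqP/eqP; lia.
      by rewrite gtn_eqF //; lia.
    by rewrite mul1r.
  by rewrite size_twist ?size_revp_size // => k; apply: sign_ext_neq0.
exists (c^-1 * (-1) ^+ E 0%N); first by rewrite mulf_neq0 ?invr_eq0 ?signr_eq0.
apply/polyP=> k; rewrite coefZ coef_revp coef_twist.
case: (ltnP k (size a)) => [lt_k|ge_k]; last by rewrite nth_default ?mulr0.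
have coefg i : g`_(i * d) = a`_i
  by rewrite gE coef_comp_poly_Xn // dvdn_mull // mulnK.
have le_k : (k * d < size g)%N.
  by rewrite sg ltnS leq_mul2r -ltnS (ltn_predK lt_k) lt_k orbT.
have lt_kn : (k * d < n)%N by apply: leq_trans size_g.
have := congr1 (fun q : {poly 'F_p} => q`_(k * d)) defc.
rewrite coefZ coef_twist coef_revp le_k sg /= -mulnBl !coefg.
have -> : st (k * d)%N = (-1) ^+ E (k * d)%N.
  by rewrite -[(k * d)%N]/(nat_of_ord (Ordinal lt_kn)) EE; apply: sign_extE.
rewrite blockE // signr_addb => /esym/(canRL (mulKf c_nz)) ->.
have -> : (-1) ^+ (b && odd k) = alt p b k.
  by rewrite /alt; case: (b); rewrite ?mul1n ?mul0n //= signr_odd.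
rewrite [RHS]mulrCA -[LHS]mulrA; congr (_ * _).
by rewrite mulrA [alt p b k * _]mulrCA alt_sqr mulr1.
Qed.

End OneDivisor.

End LiftingGroup.

(** * Spaces stable under the rotation *)

Section Generator.

Variables (p n : nat) (n_gt0 : (0 < n)%N) (eps : bool).

(** The classical argument for cyclic codes: a monic element h of least degree generates, as
    Euclidean division by h leaves no shorter nonzero remainder in the space. *)
Lemma code_generator m (B : 'M['F_p]_(m, n)) : B != 0 ->
    (forall v : 'rV_n, (v <= B)%MS ->
       (sperm (@ord_pred n) (rot_sign eps) v <= B)%MS) ->
  exists2 h, proper_divisor n eps h &
    forall v : 'rV_n, (v <= B)%MS = (h %| rVpoly v).
Proof.
move=> B_nz stab.
pose P k := [exists v : 'rV['F_p]_n,
  [&& (v <= B)%MS, v != 0 & size (rVpoly v) == k]].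
have exP : exists k, P k.
  have /rowV0Pn[v vB v_nz] := B_nz.
  by exists (size (rVpoly v)); apply/existsP; exists v; rewrite vB v_nz eqxx.
case: (ex_minnP exP) => k /existsP[v0 /and3P[v0B v0_nz /eqP size_v0]] min_k.
have size_rV (v : 'rV['F_p]_n) : (size (rVpoly v) <= n)%N by apply: size_poly.
have rV_nz (v : 'rV['F_p]_n) : v != 0 -> rVpoly v != 0.
  by apply: contra => /eqP v0'; apply/eqP/(can_inj rVpolyK);
    rewrite v0' linear0.
have h0_nz := rV_nz _ v0_nz.
have [h [h_mon size_h hB]] : exists h : {poly 'F_p},
    [/\ h \is monic, size h = k & (poly_rV h <= B)%MS].
  exists ((lead_coef (rVpoly v0))^-1 *: rVpoly v0); split.
  - by rewrite monicE lead_coefZ mulVf // lead_coef_eq0.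
  - by rewrite size_scale // invr_eq0 lead_coef_eq0.
  by rewrite linearZ /= rVpolyK scalemx_sub.
have le_hn : (size h <= n)%N by rewrite size_h -size_v0.
have h_nz := monic_neq0 h_mon.
(* Below degree n - 1 the rotation has no overflow and is plain multiplication by x. *)
have XB (q : {poly 'F_p}) : (size q < n)%N -> (poly_rV q <= B)%MS ->
    (poly_rV ('X * q)%R <= B)%MS.
  move=> sq /stab qB; have := rVpoly_sperm_pred n_gt0 eps (poly_rV q).
  rewrite poly_rV_K ?(ltnW sq) // => E.
  move: E; rewrite [q`_n.-1]nth_default; last by rewrite -ltnS prednK.
  by rewrite scale0r subr0 => <-; rewrite rVpolyK.
have mulB (q : {poly 'F_p}) : (size (q * h)%R <= n)%N ->
  (poly_rV (q * h)%R <= B)%MS.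
  elim/poly_ind: q => [|q c IH]; first by rewrite mul0r linear0 sub0mx.
  have [->|q_nz] := eqVneq q 0.
    by move=> _; rewrite mul0r add0r mul_polyC linearZ; apply: scalemx_sub.
  move=> sqh; have lt_s : (size (q * h)%R < n)%N.
    have qX_nz : q * 'X + c%:P != 0.
      by rewrite -size_poly_eq0 size_MXaddC (negPf q_nz).
    apply: leq_trans sqh.
    rewrite (size_Mmonic q_nz h_mon) (size_Mmonic qX_nz h_mon).
    rewrite size_MXaddC (negPf q_nz) /=.
    by rewrite prednK // addn_gt0 [X in _ || X]lt0n size_poly_eq0 h_nz orbT.
  rewrite mulrDl mul_polyC linearD linearZ /= addmx_sub ?scalemx_sub //.
  by rewrite -mulrA -['X * h]commr_polyX mulrA commr_polyX XB ?IH ?(ltnW lt_s).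
have memB (v : 'rV_n) : (v <= B)%MS = (h %| rVpoly v).
  apply/idP/idP => [vB|/dvdpP[q defv]]; last first.
    by rewrite -[v]rVpolyK defv mulB // -defv.
  apply: contraT; rewrite /dvdp => r_nz.
  have rE : rVpoly v %% h = rVpoly v - rVpoly v %/ h * h.
    by rewrite {2}(divp_eq (rVpoly v) h) addrC addKr.
  have s_r : (size (rVpoly v %% h)%R < size h)%N by rewrite ltn_modp.
  have rB : (poly_rV (rVpoly v %% h)%R <= B)%MS.
    rewrite rE linearB /= rVpolyK addmx_sub // eqmx_opp mulB //.
    exact: leq_trans (leq_divMp _ _) (size_rV v).
  have /min_k : P (size (rVpoly v %% h)%R).
    apply/existsP; exists (poly_rV (rVpoly v %% h)); rewrite rB poly_rV_K.
      rewrite eqxx andbT /=; apply: contra r_nz => /eqP r0.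
      rewrite -[X in X == 0](@poly_rV_K _ n) ?r0 ?linear0 //.
      exact: leq_trans (ltnW s_r) le_hn.
    exact: leq_trans (ltnW s_r) le_hn.
  by rewrite leqNgt -size_h s_r.
exists h => //; split=> //; last first.
  by apply: leq_trans le_hn; rewrite prednK // lt0n size_poly_eq0.
(* This multiple of h has degree n - 1, so one more rotation subtracts Delta from x times it;
   staying in the space forces h to divide Delta. *)
have sX : size ('X^(n - size h) * h) = n.
  by rewrite size_Mmonic ?monic_neq0 ?monicXn // size_polyXn addSn /= subnK.
have : (poly_rV ('X^(n - size h) * h)%R <= B)%MS by apply: mulB; rewrite sX.
have : lead_coef ('X^(n - size h) * h) = 1.
  by rewrite lead_coef_Mmonic // lead_coefXn.
rewrite lead_coefE sX => lc.
move/stab; rewrite memB rVpoly_sperm_pred // poly_rV_K ?sX // lc scale1r.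
rewrite mulrA addrC dvdp_addl ?dvdp_mulIr // => H.
by rewrite -dvdpNr.
Qed.

End Generator.

(** * Intermediate coverings *)

Section Coverings.

Variables (p n : nat) (n_gt0 : (0 < n)%N) (eps : bool).
Hypotheses (p_prime : prime p) (p_odd : odd p).
Notation C := (doubled_cycle n_gt0).
Notation lifts g := (lifting_group (wp n_gt0 g)).
Implicit Types (g h : {poly 'F_p}).

Lemma connected_image A B (f : morph A B) :
  (forall w, exists v, mvert f v = w) -> connected A -> connected B.
Proof.
move=> surj conA u v; have [a <-] := surj u; have [b <-] := surj v.
case/connectP: (conA a b) => pth; elim: pth a => [a _ ->|w pth IH a];
  first exact: connect0.
case/andP=> /existsP[x /andP[/eqP bx /eqP ix]] pathw lastb.
apply: connect_trans (IH w pathw lastb); apply/connect1/existsP;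
  exists (mdart f x).
by rewrite morph_beg morph_inv morph_beg bx ix !eqxx.
Qed.


Definition dart_at g (u : vert (Gamma n_gt0 g)) (y : dart C) : dart (Gamma
  n_gt0 g) :=
  let: (j, b, s) := y in
  (if s then u.1 - (-1) ^+ b *: col j (gamma_mx n g) else u.1, j, b, s).

Lemma wp_dart_at g u y : mdart (wp n_gt0 g) (dart_at u y) = y.
Proof. by case: y => [[j b] s]. Qed.

Lemma beg_dart_at g u y : beg y = mvert (wp n_gt0 g) u -> beg (dart_at u y) = u.
Proof.
case: u y => [v k] [[j b] s] /=; rewrite /wp_vert /= => Ek.
by case: s Ek => -> //; rewrite subrK.
Qed.

Lemma wp_covering g : g != 0 -> ((size g).-1 < n)%N ->
  covering_projection (wp n_gt0 g).
Proof.
move=> g_nz g_lt;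
  have conG := Gamma_connected (n_gt0 := n_gt0) p_prime p_odd g_nz g_lt.
have surj : forall w, exists v, mvert (wp n_gt0 g) v = w.
  by move=> j; exists (0, j).
split=> //; first by split=> //; apply: connected_image surj conG.
  by move=> [[j b] s]; exists (0, j, b, s).
move=> u; split=> [x y /eqP bx /eqP by_|y yu]; first by apply: wp_inj;
  rewrite bx.
by exists (dart_at u y); rewrite ?beg_dart_at ?wp_dart_at.
Qed.

Lemma wp_regular g : g != 0 -> ((size g).-1 < n)%N ->
  regular_covering (wp n_gt0 g).
Proof.
move=> g_nz g_lt; split; first exact: wp_covering.
  move=> [v j] [v' j'] /=; rewrite /wp_vert /= => <-.
  exists (tr n_gt0 (v' - v)); first by rewrite inE tr_Aut tr_lift.
  by rewrite /= /vact vperm_tr /trv /= subrKC.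
move=> [[[v j] b] s] [[[v' j'] b'] s'] [<- <- <-].
exists (tr n_gt0 (v' - v)); first by rewrite inE tr_Aut tr_lift.
by rewrite /dact dperm_tr /= subrKC.
Qed.

Section MatrixMorphism.

Variables (g h : {poly 'F_p}) (A : 'M['F_p]_(gamma_dim n h, gamma_dim n g)).
Hypotheses (g_nz : g != 0) (g_lt : ((size g).-1 < n)%N).
Hypotheses (h_nz : h != 0) (h_lt : ((size h).-1 < n)%N).
Hypothesis (AM : A *m gamma_mx n g = gamma_mx n h).

Definition mxm_vert (u : vert (Gamma n_gt0 g)) : vert (Gamma n_gt0 h) :=
  (A *m u.1, u.2).

Definition mxm_dart (x : dart (Gamma n_gt0 g)) : dart (Gamma n_gt0 h) :=
  let: (v, j, b, s) := x in (A *m v, j, b, s).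

Lemma mxm_beg x : beg (mxm_dart x) = mxm_vert (beg x).
Proof.
case: x => [[[v j] b] [] //]; rewrite /mxm_vert /= mulmxDr -scalemxAr.
by rewrite !colE mulmxA AM.
Qed.

Lemma mxm_inv x : Defs.inv (mxm_dart x) = mxm_dart (Defs.inv x).
Proof. by case: x => [[[v j] b] s]. Qed.

Definition mxm : morph (Gamma n_gt0 g) (Gamma n_gt0 h) := Morph mxm_beg mxm_inv.

Lemma mxm_composite : is_composite (wp n_gt0 g) mxm (wp n_gt0 h).
Proof. by split=> [//|[[[v j] b] s]]. Qed.

Lemma mxm_tr w : A *m w = 0 -> tr n_gt0 w \in fibre_fixing mxm.
Proof.
move=> Aw; rewrite inE tr_Aut; apply/is_liftP; split=> [[v j]|[[[v j] b] s]].
  by rewrite vperm_tr vperm1 /= /mxm_vert /= mulmxDr Aw addr0.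
by rewrite dperm_tr dperm1 /= mulmxDr Aw addr0.
Qed.

(** [A] is onto because the target matrix has full row rank, and the translations by its kernel are
    transitive on fibres. *)
Lemma mxm_regular : regular_covering mxm.
Proof.
have [D AD] : exists D, A *m D = 1%:M.
  have /row_freeP[D MD] := row_free_gamma h_nz h_lt.
  by exists (gamma_mx n g *m D); rewrite mulmxA AM.
have surjA (v : 'cV_(gamma_dim n h)) : A *m (D *m v) = v
  by rewrite mulmxA AD mul1mx.
split; first split.
- by split; apply: Gamma_connected.
- by move=> [v j]; exists (D *m v, j); rewrite /= /mxm_vert /= surjA.
- by move=> [[[v j] b] s]; exists (D *m v, j, b, s); rewrite /= surjA.
- move=> u; split=> [x y /eqP bx /eqP by_ xy|y yu].
    apply: wp_inj; first by rewrite bx.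
    by rewrite !mxm_composite.2 xy.
  have bd : beg (dart_at u (mdart (wp n_gt0 h) y)) = u.
    apply: beg_dart_at; rewrite morph_beg yu.
    by rewrite -mxm_composite.1.
  exists (dart_at u (mdart (wp n_gt0 h) y)) => //.
  apply: wp_inj; first by rewrite morph_beg bd yu.
  by rewrite -mxm_composite.2 wp_dart_at.
- move=> [v j] [v' j'] [Av <-]; exists (tr n_gt0 (v' - v)).
    by apply: mxm_tr; rewrite mulmxBr Av subrr.
  by rewrite /= /vact vperm_tr /trv /= subrKC.
move=> [[[v j] b] s] [[[v' j'] b'] s'] [Av <- <- <-].
exists (tr n_gt0 (v' - v)); first by apply: mxm_tr; rewrite mulmxBr Av subrr.
by rewrite /dact dperm_tr /= subrKC.
Qed.

End MatrixMorphism.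

Lemma card_vert_Gamma g : #|vert (Gamma n_gt0 g)| = (p ^ gamma_dim n g * n)%N.
Proof. by rewrite card_prod card_mx muln1 card_Fp // card_ord. Qed.

(** Multiples of h are multiples of g, so the matrix of h factors through that of g and [mxm] is the
    intermediate covering. Vertex counts show that neither factor is an isomorphism. *)
Lemma not_minimal g h : proper_divisor n eps g -> proper_divisor n eps h ->
  g %| h -> h != g -> lifts g \subset lifts h ->
  ~ minimal_admissible (wp n_gt0 g) (lifts g).
Proof.
move=> [g_mon _ g_lt] [h_mon _ h_lt] gh hg sub [_ _]; apply.
have g_nz := monic_neq0 g_mon; have h_nz := monic_neq0 h_mon.
have /submxP[A AM] : (gamma_mx n h <= gamma_mx n g)%MS.
  apply/row_subP=> i; rewrite sub_gamma //; apply: dvdp_trans gh _.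
  by rewrite -sub_gamma // row_sub.
have lt_s : (gamma_dim n h < gamma_dim n g)%N.
  have lt_gh : (size g < size h)%N.
    rewrite ltn_neqAle dvdp_leq // andbT; apply: contra hg => s_eq.
    by rewrite -eqp_monic // eqp_sym -dvdp_size_eqp.
  have g_gt0 : (0 < size g)%N by rewrite lt0n size_poly_eq0.
  rewrite /gamma_dim ltn_sub2l //.
  have h_gt0 : (0 < size h)%N by apply: leq_ltn_trans lt_gh.
  by rewrite -ltnS (prednK g_gt0) (prednK h_gt0).
pose f1 := @mxm g h A (esym AM).
exists (Gamma n_gt0 h), f1, (wp n_gt0 h).
split; [exact: mxm_composite|split; first exact: mxm_regular|split=> //].
- move=> [/bij_eq_card]; rewrite !card_vert_Gamma => /eqP.
  rewrite eqn_pmul2r // eqn_exp2l ?prime_gt1 // => /eqP E.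
  by rewrite E ltnn in lt_s.
- exact: wp_regular.
move=> [/bij_eq_card]; rewrite card_vert_Gamma card_ord => /eqP.
rewrite -[X in _ == X]mul1n eqn_pmul2r // -(expn0 p) eqn_exp2l ?prime_gt1 //
  => /eqP E.
by move: h_lt; rewrite -subn_gt0 -/(gamma_dim n h) E.
Qed.

End Coverings.

(** * From an intermediate covering to a divisor *)

Section IntermediateCovering.

Variables (p n : nat) (n_gt0 : (0 < n)%N) (eps : bool).
Hypotheses (p_prime : prime p) (p_odd : odd p).
Notation Cn := (doubled_cycle n_gt0).
Notation lifts g := (lifting_group (wp n_gt0 g)).

(** A covering injective on vertices is injective on darts by local injectivity, hence an
    isomorphism. *)
Lemma regular_not_inj A B (f : morph A B) :
  regular_covering f -> ~ isomorphism f -> ~ injective (mvert f).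
Proof.
case=> cov _ _ niso inj; have [_ surjv surjd _] := cov; apply: niso.
have bij (S T : finType) (k : S -> T) :
    injective k -> (forall y, exists x, k x = y) -> bijective k.
  move=> inj_k surj_k.
  have ex y : exists x, k x == y by have [x <-] := surj_k y; exists x.
  exists (fun y => xchoose (ex y)) => [x|y]; last exact/eqP/(xchooseP (ex y)).
  exact/inj_k/eqP/(xchooseP (ex (k x))).
split; apply: bij => // x y xy; apply: (covering_inj cov) => //.
by apply: inj; rewrite -!morph_beg xy.
Qed.

Variable g : {poly 'F_p}.
Hypothesis g_div : proper_divisor n eps g.
Notation r := (gamma_dim n g).
Notation M := (gamma_mx n g).
Notation Gm := (Gamma n_gt0 g).

Let g_mon : g \is monic. Proof. by case: g_div. Qed.
Let g_lt : ((size g).-1 < n)%N. Proof. by case: g_div. Qed.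
Let g_nz : g != 0. Proof. exact: monic_neq0. Qed.

Variables (B : graph) (f1 : morph Gm B) (f2 : morph B Cn).
Hypotheses (comp : is_composite (wp n_gt0 g) f1 f2).
Hypotheses (reg1 : regular_covering f1) (niso1 : ~ isomorphism f1).
Hypotheses (reg2 : regular_covering f2) (niso2 : ~ isomorphism f2).
Hypothesis adm2 : admissible f2 (lifts g).

Definition inW (w : 'cV['F_p]_r) : bool :=
  [forall x : vert Gm, mvert f1 (trv w x) == mvert f1 x].

Lemma inWP w x : inW w -> mvert f1 (trv w x) = mvert f1 x.
Proof. by move/forallP/(_ x)/eqP. Qed.

Lemma f1_fst (x y : vert Gm) : mvert f1 x = mvert f1 y -> x.2 = y.2.
Proof. by move=> xy; have := comp.1 x; rewrite xy -comp.1. Qed.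

(** Regularity of [f1] gives a deck transformation joining x and y. It also lifts the identity along
    [wp], hence is a translation. *)
Lemma f1_inW (x y : vert Gm) : mvert f1 x = mvert f1 y -> inW (y.1 - x.1).
Proof.
move=> xy; have [_ deck _] := reg1; have [h] := deck _ _ xy.
rewrite inE => /andP[Ah /is_liftP[hv hd]] hx.
have lift_h : is_lift (wp n_gt0 g) h 1%g.
  apply/is_liftP; split=> z; first by rewrite !comp.1 hv !vperm1.
  by rewrite !comp.2 hd !dperm1.
have trh := tr_unique p_prime p_odd g_nz g_lt Ah lift_h hx.
by apply/forallP=> z; rewrite -trh hv vperm1.
Qed.

Lemma trv_sub (x y : vert Gm) : x.2 = y.2 -> trv (y.1 - x.1) x = y.
Proof. by case: x y => [v i] [w j] /= ->; rewrite /trv /= subrKC. Qed.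

Lemma inWD u w : inW u -> inW w -> inW (u + w).
Proof.
move=> Wu Ww; apply/forallP=> x; apply/eqP.
by rewrite -[RHS](inWP _ Wu) -[RHS](inWP _ Ww) /trv /= addrA.
Qed.

Lemma inW0 : inW 0.
Proof. by apply/forallP=> -[v i]; rewrite /trv /= addr0. Qed.

Lemma inWZ (c : 'F_p) w : inW w -> inW (c *: w).
Proof.
move=> Ww; rewrite [c]Fp_natE scaler_nat.
by elim: (nat_of_ord c) => [|k IH]; rewrite ?mulr0n ?inW0 // mulrS inWD.
Qed.

Lemma inW_nontrivial : exists2 w, inW w & w != 0.
Proof.
case: (pickP [pred w : 'cV['F_p]_r | inW w && (w != 0)]) => [w /andP[]|none].
  by exists w.
case: (regular_not_inj reg1 niso1) => x y xy.
have := none (y.1 - x.1); rewrite /= (f1_inW xy) /= => /negbFE.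
by rewrite subr_eq0 => /eqP yx;
  rewrite -(trv_sub (f1_fst xy)) yx subrr /trv addr0 -surjective_pairing.
Qed.

Lemma inW_proper : exists w, ~~ inW w.
Proof.
case: (pickP [pred w : 'cV['F_p]_r | ~~ inW w]) => [w nW|none];
  first by exists w.
case: (regular_not_inj reg2 niso2) => x y xy.
have [[_ surj _ _] _ _] := reg1.
have [x' Ex] := surj x; have [y' Ey] := surj y; rewrite -Ex -Ey in xy *.
rewrite -!comp.1 in xy; rewrite -(trv_sub xy).
by have /negbFE Ww := none (y'.1 - x'.1); rewrite inWP.
Qed.

(* Up to a deck transformation of f2, the lift of phi along f2 agrees with    *)
(* the image of the lift of phi to Gm, by uniqueness of lifts.                *)
Lemma inW_lift phi sg e o (A : 'M['F_p]_r) : phi \in lifts g ->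
    std phi sg e o -> A \in unitmx -> A *m M = (-1) ^+ o *: sperm sg e M ->
  forall w, inW w -> inW (A *m w).
Proof.
move=> Gphi std_phi uA AM w Ww.
have Aphi : phi \in Aut_graph Cn by case/setIdP: Gphi.
pose h := lift_perm std_phi uA.
have Ah : h \in Aut_graph Gm by apply: lift_perm_Aut.
have /is_liftP[hv hd] := lift_perm_lift std_phi uA.
have /setIdP[_ /exists_inP[k Ak /is_liftP[kv kd]]] := subsetP adm2 _ Gphi.
pose x0 : vert Gm := (0, Ordinal n_gt0).
have [cov2 /(_ (vperm k (mvert f1 x0)) (mvert f1 (vperm h x0))) deck _] := reg2.
case: deck => [|d].
  by rewrite kv -!comp.1 hv.
rewrite inE => /andP[Ad /is_liftP[dv dd]] dx0.
pose a := comp_morph (aut_morph Ah) f1.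
pose b := comp_morph f1 (comp_morph (aut_morph Ak) (aut_morph Ad)).
have ab : forall u, mvert a u = mvert b u.
  apply: (@unique_lift _ _ _ f2 a b x0).
  - by move=> x y; apply: covering_inj.
  - exact: Gamma_connected.
  - move=> x; change (mdart f2 (mdart f1 (dperm h x))
                    = mdart f2 (dperm d (dperm k (mdart f1 x)))).
    by rewrite dd dperm1 kd -!comp.2 hd.
  by rewrite /= -dx0.
have hE x : mvert f1 (vperm h x) = vperm d (vperm k (mvert f1 x)) by apply: ab.
have E : mvert f1 (vperm h x0) = mvert f1 (vperm h (trv w x0)).
  by rewrite !hE inWP.
have := f1_inW E; rewrite !vperm_lift /liftv /= mulmxDr.
by rewrite mulmx0 add0r subr0.
Qed.

(** With W the translations collapsed by [f1] and U its annihilator, the space U M is stable under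
    every lifted automorphism and has dimension r - dim W. It is nonzero because [f2] is not an
    isomorphism, and smaller than the row space of M because [f1] is not. *)
Lemma intermediate_divisor :
  exists h, [/\ proper_divisor n eps h, g %| h, h != g &
    forall phi sg e o, phi \in lifts g -> std phi sg e o -> phi \in lifts h].
Proof.
pose N := #|[set w | inW w]|.
pose Wm : 'M['F_p]_(N, r) := \matrix_(i < N) (enum_val i)^T.
have memW (w : 'cV['F_p]_r) : inW w = (w^T <= Wm)%MS.
  apply/idP/idP => [Ww|/submxP[y wE]].
    have Ww' : w \in [set w | inW w] by rewrite inE.
    have -> : w^T = row (enum_rank_in Ww' w) Wm by rewrite rowK enum_rankK_in.
    exact: row_sub.
  rewrite -[w]trmxK wE mulmx_sum_row linear_sum.
  elim/big_ind: _ => [|u v|i _]; [exact: inW0|exact: inWD|].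
  rewrite linearZ /= rowK trmxK inWZ //.
  by have := enum_valP i; rewrite inE.
pose U := kermx Wm^T.
have memU (z : 'rV['F_p]_r) : (z <= U)%MS <-> forall w, inW w -> z *m w = 0.
  split=> [/sub_kermxP zW w|H].
    rewrite memW => /submxP[y wE]; rewrite -[w]trmxK wE trmx_mul mulmxA zW.
    by rewrite mul0mx.
  apply/sub_kermxP/matrixP=> i j; rewrite [i]ord1.
  have := H (enum_val j); have := enum_valP j; rewrite inE => Ww /(_ Ww).
  move=> /matrixP/(_ 0 0); rewrite !mxE => zw.
  by rewrite -[RHS]zw; apply: eq_bigr => k _; rewrite !mxE.
have free := row_free_gamma g_nz g_lt.
pose B' := U *m M.
have rankB : \rank B' = (r - \rank Wm)%N
  by rewrite mxrankMfree // mxrank_ker mxrank_tr.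
have stable phi sg e o : phi \in lifts g -> std phi sg e o ->
    forall v : 'rV_n, (v <= B')%MS -> (sperm sg e v <= B')%MS.
  move=> Gphi std_phi v /submxP[y ->].
  have Aphi : phi \in Aut_graph Cn by case/setIdP: Gphi.
  have pres : preserves sg e g.
    by apply/(lifts_stdP p_prime p_odd g_div Aphi std_phi).
  have [A uA AM] := preserves_mx g_nz g_lt o (std_inj std_phi) pres.
  rewrite /B' mulmxA sperm_mul.
  have -> : sperm sg e M = (-1) ^+ o *: (A *m M).
    by rewrite AM scalerA -expr2 sqrr_sign scale1r.
  rewrite -scalemxAr scalemx_sub // mulmxA submxMr //.
  (* The space U is stable under right multiplication by [A] because W is stable under [A]. *)
  apply/memU => w Ww; rewrite -mulmxA.
  have /memU := submxMl y U; apply.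
  exact: (inW_lift Gphi std_phi uA AM).
have rW_gt0 : (0 < \rank Wm)%N.
  have [w Ww w_nz] := inW_nontrivial; rewrite lt0n mxrank_eq0.
  apply: contra w_nz => /eqP W0; move: Ww; rewrite memW W0.
  by move/submx0null => E; rewrite -[w]trmxK E trmx0.
have rW_lt : (\rank Wm < r)%N.
  have [w nW] := inW_proper; rewrite ltn_neqAle rank_leq_col andbT.
  apply: contra nW => full; rewrite memW.
  exact: submx_full.
have B_nz : B' != 0 by rewrite -mxrank_eq0 rankB subn_eq0 -ltnNge.
have [|h h_div hB] := code_generator n_gt0 B_nz (eps := eps).
  exact: (stable _ _ _ _ (rotation_lifts n_gt0 p_prime p_odd g_div)
    (rotation_std _ _)).
have size_h : (size h <= n)%N.
  case: h_div => h_mon _ h_lt;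
    rewrite -(prednK (n := size h)) // lt0n size_poly_eq0.
  exact: monic_neq0.
exists h; split=> //.
- have : (poly_rV h <= B')%MS by rewrite hB poly_rV_K ?dvdpp.
  by move/submx_trans/(_ (submxMl _ _)); rewrite sub_gamma // poly_rV_K.
- apply: contraTneq rW_gt0 => hg; rewrite lt0n negbK.
  have : (M <= B')%MS.
    by apply/row_subP=> i; rewrite hB hg -sub_gamma // row_sub.
  move/mxrankS; rewrite rankB; have /eqP -> := free.
  by case: (\rank Wm) rW_lt => // k lt_k;
    rewrite leqNgt ltn_subrL (leq_trans _ lt_k).
move=> phi sg e o Gphi std_phi.
have Aphi : phi \in Aut_graph Cn by case/setIdP: Gphi.
apply/(lifts_stdP p_prime p_odd h_div Aphi std_phi) => v.
by rewrite -!hB; apply: stable Gphi std_phi v.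
Qed.

End IntermediateCovering.

(** * Transitivity and the kernel *)

Section Transitivity.

Variables (p n : nat) (n_gt0 : (0 < n)%N) (eps : bool).
Hypotheses (p_prime : prime p) (p_odd : odd p).
Notation C := (doubled_cycle n_gt0).
Notation lifts g := (lifting_group (wp n_gt0 g)).
Notation i0 := (Ordinal n_gt0).

Variable g : {poly 'F_p}.
Hypothesis g_div : proper_divisor n eps g.
Notation d := (Exp n g).

Let g_mon : g \is monic. Proof. by case: g_div. Qed.
Let d_gt0 : (0 < d)%N. Proof. exact: Exp_gt0. Qed.
Let dn : (d %| n)%N. Proof. exact: Exp_dvdn g_div. Qed.
Let rot_G : rotation n_gt0 eps \in lifts g.
Proof. exact: rotation_lifts. Qed.

Lemma supp_Exp i : g`_i != 0 -> (d %| i)%N.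
Proof.
have /polyP/(_ i) -> := associated_monicE n g_mon.
by rewrite coef_comp_poly_Xn //; case: ifP; rewrite ?eqxx.
Qed.

Lemma flips_liftsE s :
  flips n_gt0 s \in lifts g <-> (forall i j : 'I_n, i = j %[mod d] ->
    s i = s j).
Proof.
split; first exact: (flips_periodic p_prime p_odd g_div).
exact: (flips_lifts n_gt0 p_prime p_odd g_div d_gt0 dn supp_Exp).
Qed.

Lemma rotation_iter k j b t : exists c,
  dperm (rotation n_gt0 eps ^+ k)%g (j, b, t)
    = (iter k (@ord_pred n) j, b (+) c, t).
Proof.
elim: k => [|k [c IH]]; first by exists false; rewrite dperm1 addbF.
rewrite expgSr dpermM IH rotation_std.
by exists (c (+) rot_sign eps (iter k (@ord_pred n) j)); rewrite addbA addbF.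
Qed.

Lemma pred_iter_trans (i j : 'I_n) : exists k, j = iter k (@ord_pred n) i.
Proof.
have [k ->] := iter_ordS_trans j i; exists k.
by elim: k => // k IH; rewrite iterSr iterS ordSK.
Qed.

Lemma vertex_transitive : [transitive lifts g, on [set: vert C] | vact_action
  C].
Proof.
apply/imsetP; exists i0 => //; apply/esym/setP=> j; rewrite inE.
have [k ->] := pred_iter_trans i0 j.
apply/orbitP; exists (rotation n_gt0 eps ^+ k)%g; first exact: groupX.
rewrite /= /vact; elim: k => [|k IH]; first by rewrite vperm1.
by rewrite expgSr vpermM IH /vperm permE.
Qed.

(** A power of the rotation reaches the edge index; a constant flip, which always lifts, corrects
    the label. *)
Lemma dart_move j b : exists2 phi, phi \in lifts g &
  forall t, dperm phi (i0, false, t) = (j, b, t).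
Proof.
have [k ->] := pred_iter_trans i0 j.
have [c Hc] := rotation_iter k i0 false false.
exists (rotation n_gt0 eps ^+ k * flips n_gt0 (fun => b (+) c))%g.
  by rewrite groupM ?groupX //; apply/flips_liftsE.
move=> t; have E : dperm (rotation n_gt0 eps ^+ k)%g (i0, false, t)
    = (iter k (@ord_pred n) i0, false (+) c, t).
  case: t => //; have /setIdP[/Aut_graphP[_ inv_r] _] := groupX k rot_G.
  by have := inv_r (i0, false, false); rewrite Hc => /esym.
by rewrite dpermM E flips_std addFb addbF addbC addbK.
Qed.

Lemma edge_transitive : [transitive lifts g, on edges C | (dact_action C)^*].
Proof.
pose x0 : dart C := (i0, false, false).
have act phi x : phi \in lifts g -> ((dact_action C)^*)%act [set x;
  Defs.inv x] phi
    = [set dperm phi x; Defs.inv (dperm phi x)].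
  case/setIdP=> /Aut_graphP[_ inv_phi] _.
  by rewrite [LHS](setactE (dact_action C)) imsetU1 imset_set1 inv_phi.
apply/imsetP; exists [set x0; Defs.inv x0]; first by apply/imsetP; exists x0.
apply/setP=> E; apply/imsetP/orbitP => [[x _ ->]|[phi Gphi <-]]; last first.
  by exists (dperm phi x0); rewrite // act.
have edge_inv (y : dart C) : [set Defs.inv y; Defs.inv (Defs.inv y)] = [set y;
  Defs.inv y].
  by rewrite inv_inv setUC.
case: x => [[j b] t]; have [phi Gphi Hphi] := dart_move j b.
exists phi => //; rewrite act // Hphi; case: t => //.
by rewrite -[RHS]edge_inv.
Qed.

Lemma refl_dart_transitive b : refl b (associated n g) ->
  [transitive lifts g, on [set: dart C] | dact_action C].
Proof.
move=> rg; have GR :=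
  reflection_lifts n_gt0 p_prime p_odd g_div d_gt0 (associated_monicE n g_mon)
    rg.
set e := fun j : 'I_n => _ in GR.
apply/imsetP; exists (i0, false, false) => //; apply/esym/setP=> -[[j c] t].
rewrite inE; apply/orbitP; have [phi Gphi Hphi] := dart_move j c.
case: t; last by exists phi; rewrite //= /dact Hphi.
have [psi Gpsi Hpsi] := dart_move (rev_ord i0) (e i0).
exists (reflection n_gt0 e * psi^-1 * phi)%g.
  by rewrite !groupM ?groupV.
rewrite /= /dact !dpermM reflection_std /=.
have -> : dperm psi^-1%g (rev_ord i0, e i0, true) = (i0, false, true).
  by rewrite -Hpsi -dpermM mulgV dperm1.
exact: Hphi.
Qed.

(** An element inverting the dart a_0 cannot be a flip times a power of the rotation, as these
    preserve direction, so it yields a reflection that lifts. *)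
Lemma dart_transitive_refl : (2 < n)%N ->
  [transitive lifts g, on [set: dart C] | dact_action C] ->
  exists b, refl b (associated n g).
Proof.
move=> n_gt2 tr;
  have [phi Gphi] :=
    atransP2 tr (in_setT (i0, false, false)) (in_setT (i0, false, true)).
rewrite /= /dact => Hphi.
have Aphi : phi \in Aut_graph C by case/setIdP: Gphi.
have [k [[s Es]|[e Ee]]] := aut_cases n_gt2 eps Aphi.
  have : dperm (phi * rotation n_gt0 eps ^+ k)%g (i0, false, false)
       = dperm (flips n_gt0 s) (i0, false, false) by rewrite Es.
  rewrite dpermM -Hphi flips_std.
  by have [c ->] := rotation_iter k i0 false true.
apply: (reflection_refl p_prime p_odd g_div (e := e)).
by rewrite -Ee groupM ?groupX.
Qed.

Lemma size_le_n : (size g <= n)%N.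
Proof.
case: g_div => _ _; rewrite -(prednK (n := size g)) // lt0n size_poly_eq0.
exact: monic_neq0.
Qed.

Lemma lifting_group_Aut : (2 < n)%N -> lifts g :=: Aut_graph C <-> g = 1.
Proof.
move=> n_gt2; split=> [GA|g1].
  have := leqnn (size g);
    case: (leqP (size g) 1) => [/(monic_size1 g_mon)//|g_gt1 _].
  have lt_d : (d < n)%N.
    have [gE _] := Exp_max n g_gt1.
    exact: leq_trans (in_exp_lt g_gt1 gE) size_le_n.
  (* Exchanging only a_0 and b_0 is not d-periodic when d < n: the indices 0 and d disagree. *)
  have := flips_Aut n_gt0 (fun j => j == i0); rewrite -GA.
  move/flips_liftsE/(_ i0 (Ordinal lt_d)); rewrite /= mod0n modnn eqxx.
  by move/(_ erefl)/esym/eqP/(congr1 val) => /= d0; move: d_gt0; rewrite d0.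
apply/eqP; rewrite eqEsubset; apply/andP; split.
  by apply/subsetP=> phi /setIdP[].
apply/subsetP=> phi Aphi; have [sg [e [o [std_phi _]]]] := aut_std n_gt2 Aphi.
apply/(lifts_stdP p_prime p_odd g_div Aphi std_phi) => v _.
by rewrite g1 dvd1p.
Qed.

(** Either g = 1, or n = 2 and g = x + c with c^2 = (-1)^eps, which is reflexible with scalar c and
    type [eps]. *)
Lemma refl_small : (n <= 2)%N -> exists b, refl b (associated n g).
Proof.
move=> n_le2; case: (leqP (size g) 1) => [/(monic_size1 g_mon) g1|g_gt1].
  by rewrite g1; apply/weakly_reflexibleP; [apply: monic1|left].
have size2 : size g = 2.
  by apply/eqP; rewrite eqn_leq g_gt1 (leq_trans size_le_n).
have n2 : n = 2 by apply/eqP; rewrite eqn_leq n_le2 -size2 size_le_n.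
have d1 : d = 1%N.
  have [gE _] := Exp_max n g_gt1; have := in_exp_lt g_gt1 gE.
  by rewrite size2; case: (d) d_gt0 => [|[]].
have -> : associated n g = g.
  by rewrite [RHS](associated_monicE n g_mon) d1 expr1 comp_polyXr.
have g1 : g`_1 = 1.
  by move/monicP: g_mon; rewrite lead_coefE size2.
have g2 k : g`_k.+2 = 0 by apply: nth_default; rewrite size2.
have gE : g = 'X - (- g`_0)%:P.
  apply/polyP=> i; rewrite coefB coefX coefC.
  by case: i => [|[|i]] /=;
    rewrite ?g1 ?g2 ?mulr0n ?mulr1n ?sub0r ?opprK ?subr0 ?oppr0.
have : root (Delta p n eps) (- g`_0) by rewrite -dvdp_XsubCl -gE; case: g_div.
rewrite /root /Delta n2 !hornerE sqrrN subr_eq0 => /eqP g02.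
have g0 : g`_0 != 0 by case: g_div => _ /(dvd_Delta_coef0 n_gt0).
exists eps, g`_0 => //; apply/polyP=> i.
rewrite coefZ coef_twist coef_revp size2; case: i => [|[|i]] /=.
- by rewrite g1 /alt muln0 mulr1 mul1r.
- by rewrite g1 /alt muln1 mulr1 -expr2 g02.
by rewrite g2 !mulr0.
Qed.

Lemma dart_transitiveE :
  [transitive lifts g, on [set: dart C] | dact_action C] <-> weakly_reflexible
    n g.
Proof.
split=> [tr|/(weakly_reflexibleP n g_mon)[b]]; last exact: refl_dart_transitive.
apply/weakly_reflexibleP => //.
by case: (leqP n 2) => [/refl_small|n_gt2] //; apply: dart_transitive_refl.
Qed.

Lemma Z2_add (a b : 'Z_2) : (a + b != 0) = (a != 0) (+) (b != 0).
Proof.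
by case: a b => [[|[|//]] ia] [[|[|//]] ib].
Qed.

Lemma Z2_inj (a b : 'Z_2) : (a != 0) = (b != 0) -> a = b.
Proof.
by case: a b => [[|[|//]] ia] [[|[|//]] ib] // _; apply: val_inj.
Qed.

Definition kernel_flips (x : 'rV['Z_2]_d) : vdperm C :=
  flips n_gt0 (fun j => x 0 (Ordinal (ltn_pmod j d_gt0)) != 0).

Lemma kernel_flipsM : {in [set: 'rV['Z_2]_d] &,
  {morph kernel_flips : x y / (x * y)%g >-> (x * y)%g}}.
Proof.
move=> x y _ _; apply: aut_eq; rewrite ?groupM ?flips_Aut //.
move=> [[j b] t]; rewrite dpermM !flips_std !addbF -addbA;
  congr (_, _ (+) _, _).
by rewrite FinRing.zmodMgE mxE Z2_add.
Qed.

(** For n > 2, fixing all vertices excludes reversal and fixes edge indices, so the kernel consists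
    of the d-periodic flips, each given by d bits. *)
Lemma kernel_isog : (2 < n)%N ->
  'C_(lifts g)([set: vert C] | vact_action C) \isog [set: 'rV['Z_2]_d].
Proof.
move=> n_gt2.
pose f := Morphism kernel_flipsM.
have inj_f : ('injm f)%g.
  apply/injmP => x y _ _ Exy; apply/rowP=> k.
  have lt_k : (k < n)%N by apply: leq_trans (ltn_ord k) (dvdn_leq n_gt0 dn).
  have := congr1 (fun h : vdperm C => dperm h (Ordinal lt_k, false, false)) Exy.
  rewrite /= !flips_std => -[].
  have -> : Ordinal (ltn_pmod (Ordinal lt_k) d_gt0) = k.
    by apply: val_inj; rewrite /= modn_small.
  exact: Z2_inj.
suff -> : 'C_(lifts g)([set: vert C] | vact_action C)
  = (f @* [set: 'rV['Z_2]_d])%g.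
  by rewrite isog_sym; apply: sub_isog.
apply/setP=> phi; apply/setIP/morphimP => [[Gphi fix_phi]|[x _ _ ->]];
  last first.
  split; first by apply/flips_liftsE => i j Eij; congr (x 0 _ != 0);
    apply: val_inj.
  by apply/astabP=> j _; rewrite /= /vact /vperm /= perm1.
have Aphi : phi \in Aut_graph C by case/setIdP: Gphi.
have [sg [e [o [std_phi step]]]] := aut_std n_gt2 Aphi.
have /Aut_graphP[bphi _] := Aphi.
have vphi j : vperm phi j = j by have /astabP := fix_phi; apply; rewrite inE.
have o_false : o = false.
  case: o std_phi step => // std_phi step.
  have sgS j : ordS (sg j) = j.
    by have := bphi (j, false, false); rewrite std_phi /= vphi.
  have := sgS (ordS i0); rewrite step ord_predK => E.
  by case: (@ordS2_neq n n_gt2 i0); rewrite -E.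
have sgE j : sg j = j.
  have := bphi (j, false, false); rewrite std_phi o_false /= vphi.
  by [].
have phiE : phi = flips n_gt0 e.
  apply: aut_eq; rewrite ?flips_Aut // => -[[j b] t].
  by rewrite std_phi flips_std sgE o_false.
have per : forall i j : 'I_n, i = j %[mod d] -> e i = e j.
  by apply/flips_liftsE; rewrite -phiE.
have lt_n (k : 'I_d) : (k < n)%N
  by apply: leq_trans (ltn_ord k) (dvdn_leq n_gt0 dn).
exists (\row_k (e (Ordinal (lt_n k)))%:R) => //.
rewrite phiE; apply: aut_eq; rewrite ?flips_Aut // => -[[j b] t].
rewrite !flips_std mxE; congr (_, _ (+) _, _).
rewrite (per j (Ordinal (lt_n (Ordinal (ltn_pmod j d_gt0)))));
  last by rewrite /= modn_mod.
by case: (e _).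
Qed.

End Transitivity.

(** * Minimality *)

Section Minimality.

Variables (p n : nat) (n_gt0 : (0 < n)%N) (eps : bool).
Hypotheses (p_prime : prime p) (p_odd : odd p).
Notation C := (doubled_cycle n_gt0).
Notation lifts g := (lifting_group (wp n_gt0 g)).

Variable g : {poly 'F_p}.
Hypothesis g_div : proper_divisor n eps g.
Notation d := (Exp n g).
Notation f := (associated n g).

Let g_mon : g \is monic. Proof. by case: g_div. Qed.
Let d_gt0 : (0 < d)%N. Proof. exact: Exp_gt0. Qed.
Let dn : (d %| n)%N. Proof. exact: Exp_dvdn g_div. Qed.
Let gE : g = f \Po 'X^d. Proof. exact: associated_monicE. Qed.
Let f_div : proper_divisor (n %/ d) eps f.
Proof. exact: proper_divisor_associated. Qed.

Lemma monic_dvd_size_lt (a b : {poly 'F_p}) :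
  a \is monic -> b \is monic -> a %| b -> b != a -> (size a < size b)%N.
Proof.
move=> a_mon b_mon ab neq; rewrite ltn_neqAle dvdp_leq ?monic_neq0 // andbT.
by apply: contra neq => s_eq; rewrite -eqp_monic // eqp_sym -dvdp_size_eqp.
Qed.

(** For g = 1 the quotient n / d is 1 and leaves no other proper divisor. So f is nonconstant, and a
    larger h of degree below n / d forces n > 2, as [aut_cases] requires. *)
Lemma multiple_size h : proper_divisor (n %/ d) eps h -> f %| h -> h != f ->
  (1 < size g)%N /\ (2 < n)%N.
Proof.
move=> [h_mon _ h_lt] fh hf; have [f_mon _ _] := f_div.
have lt_fh := monic_dvd_size_lt f_mon h_mon fh hf.
case: (leqP (size g) 1) => [g1|g_gt1].
  have h1 : (size h <= 1)%N.
    have := h_lt; rewrite (Exp_const n g1) divnn n_gt0 ltnS leqn0 => /eqP h0.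
    by rewrite -(ltn_predK lt_fh) h0.
  case/eqP: hf; rewrite (monic_size1 h_mon h1) (monic_size1 f_mon) //.
  exact: leq_trans (ltnW lt_fh) h1.
have f_gt1 := associated_size_gt1 n g_gt1; split=> //.
have h_gt2 : (2 < size h)%N := leq_ltn_trans f_gt1 lt_fh.
have h_le : (size h <= n %/ d)%N by rewrite -(ltn_predK h_gt2).
exact: leq_trans h_gt2 (leq_trans h_le (leq_div n d)).
Qed.

(** Whatever lifts along g lifts along h(x^d): the rotation and d-periodic flips always do. If
    reflections lift along g, a common type gives one that lifts along both, and any other differs
    from it by a flip. *)
Lemma multiple_not_minimal h : proper_divisor (n %/ d) eps h -> f %| h ->
  h != f ->
    (~ (exists b, refl b f) \/ exists2 b, refl b f & refl b h) ->
  ~ minimal_admissible (wp n_gt0 g) (lifts g).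
Proof.
move=> h_div fh hf alt_h; have [g_gt1 n_gt2] := multiple_size h_div fh hf.
have H_div : proper_divisor n eps (h \Po 'X^d).
  by apply/proper_divisor_comp.
have rotg := rotation_lifts n_gt0 p_prime p_odd g_div.
have roth := rotation_lifts n_gt0 p_prime p_odd H_div.
have flip s : flips n_gt0 s \in lifts g -> flips n_gt0 s \in lifts (h \Po 'X^d).
  move/(flips_periodic p_prime p_odd g_div);
    apply: (flips_lifts n_gt0 p_prime p_odd H_div) => //.
  by move=> i; rewrite coef_comp_poly_Xn //; case: ifP; rewrite ?eqxx.
apply: (not_minimal p_prime p_odd g_div H_div).
- by rewrite {1}gE dvdp_comp_Xn.
- by apply: contra hf => /eqP E; rewrite -(contract_comp h d_gt0) E.
apply/subsetP=> phi Gphi; have Aphi : phi \in Aut_graph C by case/setIdP: Gphi.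
have [k [[s Es]|[e Ee]]] := aut_cases n_gt2 eps Aphi.
  rewrite -(groupMr _ (groupX k roth)) Es flip // -Es.
  by rewrite groupM ?groupX.
have Ge : reflection n_gt0 e \in lifts g by rewrite -Ee groupM ?groupX.
rewrite -(groupMr _ (groupX k roth)) Ee.
case: alt_h => [nr|[b rf rh]].
  by case: nr; apply: (reflection_refl p_prime p_odd g_div Ge).
pose e0 (j : 'I_n) := b && odd (j %/ d).
have Gg : reflection n_gt0 e0 \in lifts g.
  exact: (reflection_lifts n_gt0 p_prime p_odd g_div d_gt0 gE rf).
have Gh : reflection n_gt0 e0 \in lifts (h \Po 'X^d).
  exact: (reflection_lifts n_gt0 p_prime p_odd H_div d_gt0 erefl rh).
have E : (flips n_gt0 (fun j => e j (+) e0 j) * reflection n_gt0 e0)%g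
       = reflection n_gt0 e.
  apply: aut_eq; rewrite ?groupM ?flips_Aut ?reflection_Aut // => -[[j c] t].
  by rewrite dpermM flips_std !reflection_std addbA -!addbA addbb !addbF.
rewrite -E groupMr // flip // -(groupMr _ Gg) E //.
Qed.

Lemma intermediate_multiple (B : graph) (f1 : morph (Gamma n_gt0 g) B)
    (f2 : morph B C) :
    is_composite (wp n_gt0 g) f1 f2 -> regular_covering f1 ->
      ~ isomorphism f1 ->
    regular_covering f2 -> admissible f2 (lifts g) -> ~ isomorphism f2 ->
  exists h, [/\ proper_divisor (n %/ d) eps h, f %| h, h != f &
    (exists b, refl b f) -> weakly_reflexible (n %/ d) h].
Proof.
move=> comp reg1 niso1 reg2 adm2 niso2.
have [H [H_div gH Hg lift_H]] := intermediate_divisor p_prime p_odd g_div comp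
                                   reg1 niso1 reg2 niso2 adm2.
have H_mon : H \is monic by case: H_div.
have supp i : H`_i != 0 -> (d %| i)%N.
  move=> Hi; have lt_i : (i < n)%N.
    apply: leq_trans (size_le_n H_div); rewrite ltnNge.
    by apply: contra Hi => /leq_sizeP->.
  (* The flip trivial exactly at the multiples of d lifts along g, hence along H; having equal signs
     on the support of H, it confines that support to multiples of d. *)
  have := flips_supp p_prime p_odd H_div (s := fun j => (j %% d != 0)%N) _
            (i := Ordinal lt_i) Hi.
  rewrite /= mod0n eqxx => E; rewrite /dvdn; apply/negbFE/E.
  apply: lift_H; last exact: flips_std.
  apply: (flips_lifts n_gt0 p_prime p_odd g_div d_gt0 dn).
    exact: (supp_Exp n_gt0 g_div).
  by move=> j j' ->.
have HE : H = contract d H \Po 'X^d.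
  by have /(in_exp_suppP _ d_gt0)/andP[_ /eqP] := supp.
have h_div : proper_divisor (n %/ d) eps (contract d H).
  by apply/proper_divisor_comp; rewrite -?HE.
have fh : f %| contract d H by rewrite -(dvdp_comp_Xn _ _ d_gt0) -HE -gE.
have hf : contract d H != f.
  by apply: contra Hg => /eqP hf; rewrite HE hf -gE.
exists (contract d H); split=> // -[b rf].
have [h_mon _ _] := h_div; have [f_mon _ _] := f_div.
have h_gt1 : (1 < size (contract d H))%N.
  apply: leq_ltn_trans (monic_dvd_size_lt f_mon h_mon fh hf).
  by rewrite lt0n size_poly_eq0 monic_neq0.
apply/weakly_reflexibleP => //.
rewrite -(associated_comp n _ d_gt0 h_gt1) -HE.
apply: (reflection_refl p_prime p_odd H_div (e := fun j => b && odd (j %/ d))).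
apply: lift_H; last exact: reflection_std.
exact: (reflection_lifts n_gt0 p_prime p_odd g_div d_gt0 gE rf).
Qed.

Let regular_g : regular_covering (wp n_gt0 g).
Proof. by case: g_div => _ _ g_lt; apply: wp_regular; rewrite ?monic_neq0. Qed.

Let admissible_g : admissible (wp n_gt0 g) (lifts g).
Proof. exact: subxx. Qed.

Lemma minimal_maximal : ~ weakly_reflexible n g ->
  minimal_admissible (wp n_gt0 g) (lifts g) <-> maximal_divisor (n %/ d) eps f.
Proof.
move=> nwr; have nrf : ~ exists b, refl b f.
  by move/(weakly_reflexibleP n g_mon).
split=> [min_g|[_ max_f]].
  split=> // h h_div fh; apply/eqP/negPn/negP => hf.
  by case: (multiple_not_minimal h_div fh hf) => //; left.
split=> // -[B [f1 [f2 [comp [reg1 niso1] [reg2 adm2 niso2]]]]].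
have [h [h_div fh hf _]] :=
  intermediate_multiple comp reg1 niso1 reg2 adm2 niso2.
by case/eqP: hf; apply: max_f.
Qed.

(** The quotient by a weakly reflexible h need not admit the reflections of G; the divisor k of h
    from [intermediate_refl] has the type of f, so its quotient does. *)
Lemma minimal_maximal_refl : weakly_reflexible n g ->
  minimal_admissible (wp n_gt0 g) (lifts g) <->
    maximal_weakly_reflexible_divisor (n %/ d) eps f.
Proof.
move=> /(weakly_reflexibleP n g_mon)[b rf]; have [f_mon _ _] := f_div.
split=> [min_g|[_ _ max_f]]; last first.
  split=> // -[B [f1 [f2 [comp [reg1 niso1] [reg2 adm2 niso2]]]]].
  have [h [h_div fh hf wrh]] :=
    intermediate_multiple comp reg1 niso1 reg2 adm2 niso2.
  by case/eqP: hf; apply: max_f => //; apply: wrh; exists b.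
split=> //.
  apply/weakly_reflexibleP => //; exists b.
  case: (leqP (size g) 1) => [/(monic_size1 g_mon) g1|g_gt1].
    have f1 : f = 1 by rewrite g1 associated1.
    by rewrite f1 in rf *; rewrite associated1.
  by rewrite associated_idem.
move=> h h_div wrh fh; apply/eqP/negPn/negP => hf.
have [g_gt1 n_gt2] := multiple_size h_div fh hf.
have [h_mon h_dvd h_lt] := h_div.
have n'_gt0 : (0 < n %/ d)%N by apply: leq_trans h_lt.
have [k [k_mon fk kh kf rk]] := intermediate_refl p_prime p_odd f_mon h_mon
  (dvd_Delta_coef0 n'_gt0 h_dvd) (associated_size_gt1 n g_gt1)
  (Exp_associated n n g_gt1) fh hf rf wrh.
have k_div : proper_divisor (n %/ d) eps k.
  split=> //; first exact: dvdp_trans kh h_dvd.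
  apply: leq_ltn_trans h_lt; rewrite -!subn1 leq_sub2r // dvdp_leq //.
  exact: monic_neq0.
by case: (multiple_not_minimal k_div fk kf) => //; right; exists b.
Qed.

End Minimality.

Theorem theorem1p4 (p : nat) (p_prime : prime p) (p_odd : odd p)
    (n : nat) (n_gt0 : (0 < n)%N) (eps : bool) (g : {poly 'F_p})
    (g_div : proper_divisor n eps g) :
  let C := doubled_cycle n_gt0 in
  let G := lifting_group (wp n_gt0 g) in
  let d := Exp n g in
  let g_d := associated n g in
  [/\ (* (1) *)
      [/\ (2 < n)%N ->
            'C_G([set: vert C] | vact_action C) \isog [set: 'rV['Z_2]_d],
          [transitive G, on [set: vert C] | vact_action C] &
          [transitive G, on edges C | (dact_action C)^*]],
      (* (2) *)
      ([transitive G, on [set: dart C] | dact_action C]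
         <-> weakly_reflexible n g) /\
      ((2 < n)%N -> (G :=: Aut_graph C <-> g = 1)),
      (* (3) *)
      ~ weakly_reflexible n g ->
        (minimal_admissible (wp n_gt0 g) G <-> maximal_divisor (n %/ d) eps g_d) &
      (* (4) *)
      (weakly_reflexible n g ->
        (minimal_admissible (wp n_gt0 g) G
           <-> maximal_weakly_reflexible_divisor (n %/ d) eps g_d)) /\
      ((2 < n)%N -> minimal_admissible (wp n_gt0 (1 : {poly 'F_p})) (Aut_graph C))].
Proof.
move=> C G d g_d; split.
- split; first exact: (kernel_isog n_gt0 p_prime p_odd g_div).
    exact: vertex_transitive g_div.
  exact: edge_transitive g_div.
- split; first exact: (dart_transitiveE n_gt0 p_prime p_odd g_div).
  exact: (lifting_group_Aut n_gt0 p_prime p_odd g_div).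
- exact: minimal_maximal.
split; first exact: minimal_maximal_refl.
move=> n_gt2; have div1 : proper_divisor n eps (1 : {poly 'F_p}).
  by split; rewrite ?monic1 ?dvd1p ?size_poly1.
have <- := (lifting_group_Aut n_gt0 p_prime p_odd div1 n_gt2).2 erefl.
apply/(minimal_maximal_refl n_gt0 p_prime p_odd div1 (or_introl erefl)).
(* As Exp(1) = n, the relevant Delta has degree 1, so its only proper divisor is 1. *)
rewrite associated1 Exp_const ?size_poly1 // divnn n_gt0.
split; [by split; rewrite ?monic1 ?dvd1p ?size_poly1|by left|].
move=> h [h_mon _ h_lt] _ _; apply: monic_size1 => //.
by rewrite -(prednK (n := size h)) // lt0n size_poly_eq0 monic_neq0.
Qed.
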